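(* Let $\beta\in[1,\infty)$. A state $\phi$ of $\mathcal T(\mathbb N\rtimes\mathbb N^\times)$ is a KMS$_\beta$ state for $\sigma$ if and only if for every $a,b\in\mathbb N^\times$ and $m,n\in\mathbb N$ we have $$\phi(s^mv_av_b^*s^{*n})=\begin{cases}0&\text{if }a\ne b\text{ or }m\not\equiv n\pmod a,\\ a^{-\beta}\,\phi\big(s^{((\frac{m-n}{a}))}\big)&\text{if }a=b\text{ and }m\equiv n\pmod a.\end{cases}$$
   Context: $\mathbb N=\{0,1,2,\dots\}$; $\mathbb N^\times$ is the multiplicative semigroup of positive integers; $\mathbb N\rtimes\mathbb N^\times$ has product $(m,a)(n,b)=(m+an,ab)$. $\mathcal T(\mathbb N\rtimes\mathbb N^\times)$ is the $C^*$-algebra generated by the isometries $T_ye_x=e_{yx}$ on $\ell^2(\mathbb N\rtimes\mathbb N^\times)$; $s:=T_{(1,1)}$, $v_a:=T_{(0,a)}$. The elements $s^mv_av_b^*s^{*n}$ span a dense subspace. The dynamics $\sigma:\mathbb R\to\operatorname{Aut}\mathcal T(\mathbb N\rtimes\mathbb N^\times)$ satisfies $\sigma_t(s)=s$, $\sigma_t(v_p)=p^{it}v_p$ for $p$ prime. For $\beta\in(0,\infty)$ a state $\phi$ is KMS$_\beta$ if $\phi(dc)=\phi(c\,\sigma_{i\beta}(d))$ for all $\sigma$-analytic $c,d$ (those for which $t\mapsto\sigma_t(c)$ extends to an entire function). Notation: for $k\in\mathbb Z$, $s^{((k))}$ means $s^k$ when $k\ge0$ and $s^{*(-k)}$ when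 $k<0$. *)

(* Defs.v *)
From HB Require Import structures.
From mathcomp Require Import all_boot all_order all_algebra finmap.
From mathcomp Require Import complex ring.
From mathcomp Require Import all_classical all_reals all_analysis.

Set Implicit Arguments.
Unset Strict Implicit.
Unset Printing Implicit Defensive.

Import Order.TTheory GRing.Theory Num.Theory.
Import numFieldNormedType.Exports.

Local Open Scope classical_set_scope.
Local Open Scope ring_scope.
Local Open Scope complex_scope.

Section SquareSummable.
Variables (R : realType) (I : choiceType).
Local Notation C := R[i].
Implicit Types f g : I -> C.

Definition sqmod (z : C) : R := complex.Re z ^+ 2 + complex.Im z ^+ 2.

Definition sqsum f : \bar R := \esum_(x in [set: I]) (sqmod (f x))%:E.

Definition square_summable : pred (I -> C) :=
  fun f => `[< (sqsum f < +oo)%E >].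

Lemma sqmod_ge0 z : 0 <= sqmod z.
Proof. by rewrite /sqmod addr_ge0// sqr_ge0. Qed.

Lemma sqmodM z w : sqmod (z * w) = sqmod z * sqmod w.
Proof. by case: z w => [a b] [c d]; rewrite /sqmod /=; ring. Qed.

Lemma sqmod0_eq0 z : sqmod z = 0 -> z = 0.
Proof.
case: z => a b; rewrite /sqmod /= => /eqP.
by rewrite paddr_eq0 ?sqr_ge0// !sqrf_eq0 => /andP[/eqP -> /eqP ->].
Qed.

Lemma sqmodV z : z != 0 -> sqmod z^-1 * sqmod z = 1.
Proof.
by move=> z0; rewrite -sqmodM mulVf// /sqmod /= expr0n expr1n /= addr0.
Qed.

Lemma normc_sqmod z : `|z| = (Num.sqrt (sqmod z))%:C.
Proof. by rewrite normc_def. Qed.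

Lemma sqmodD (t : R) z w : 0 < t ->
  sqmod (z + w) <= (1 + t) * sqmod z + (1 + t^-1) * sqmod w.
Proof.
move=> t0; rewrite -subr_ge0.
have -> : (1 + t) * sqmod z + (1 + t^-1) * sqmod w - sqmod (z + w) =
    t^-1 * sqmod (t%:C * z - w).
  case: z w => [a b] [c d]; rewrite /sqmod /=.
  by field; rewrite gt_eqF.
by rewrite mulr_ge0 ?sqmod_ge0// invr_ge0 ltW.
Qed.

Lemma sqsum_ge0 f : (0 <= sqsum f)%E.
Proof. by apply: esum_ge0 => x _; rewrite lee_fin sqmod_ge0. Qed.

Lemma square_summableE f : f \in square_summable = (sqsum f \is a fin_num).
Proof.
rewrite ge0_fin_numE ?sqsum_ge0//; apply/idP/idP => [/asboolP//|?].
exact/asboolP.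
Qed.

Lemma le_sqsumZ c f : (sqsum (c *: f) <= (sqmod c)%:E * sqsum f)%E.
Proof.
apply: ge_ereal_sup => _ [A [finA _] <-].
have -> : (\sum_(x \in A) (sqmod ((c *: f) x))%:E =
           (sqmod c)%:E * \sum_(x \in A) (sqmod (f x))%:E)%E.
  rewrite ge0_mule_fsumr; last by move=> x; rewrite lee_fin sqmod_ge0.
  by apply: eq_fsbigr => x _; rewrite -EFinM -sqmodM.
rewrite lee_wpmul2l ?lee_fin ?sqmod_ge0//.
by apply: ereal_sup_ubound; exists A.
Qed.

Lemma sqsumZ c f : (sqsum (c *: f) = (sqmod c)%:E * sqsum f)%E.
Proof.
have [->|c0] := eqVneq c 0.
  rewrite (_ : sqmod 0 = 0) ?mul0e; last by rewrite /sqmod /= expr0n addr0.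
  apply: esum1 => x _; rewrite /sqmod.
  by rewrite (_ : (0 *: f) x = 0)/= ?expr0n ?addr0// -[LHS]/(0 * f x) mul0r.
apply/eqP; rewrite eq_le le_sqsumZ/=.
have := le_sqsumZ c^-1 (c *: f); rewrite scalerA mulVf// scale1r => h.
have := lee_wpmul2l _ h; move=> /(_ (sqmod c)%:E); rewrite lee_fin sqmod_ge0.
by move=> /(_ isT)/le_trans; apply; rewrite muleA -EFinM mulrC sqmodV// mul1e.
Qed.

Lemma sqsumD (t : R) f g : 0 < t ->
  (sqsum (f + g)%R <= (1 + t)%:E * sqsum f + (1 + t^-1)%:E * sqsum g)%E.
Proof.
move=> t0; apply: ge_ereal_sup => _ [A [finA _] <-].
apply: (@le_trans _ _ ((1 + t)%:E * (\sum_(x \in A) (sqmod (f x))%:E) +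
    (1 + t^-1)%:E * (\sum_(x \in A) (sqmod (g x))%:E))%E).
  rewrite !ge0_mule_fsumr; try by move=> x; rewrite lee_fin sqmod_ge0.
  rewrite -fsbig_split//=; apply: lee_fsum => // x _.
  by rewrite -!EFinM -EFinD lee_fin sqmodD.
apply: leeD; apply: lee_wpmul2l.
- by rewrite lee_fin addr_ge0// ltW.
- by apply: ereal_sup_ubound; exists A.
- by rewrite lee_fin addr_ge0// invr_ge0 ltW.
- by apply: ereal_sup_ubound; exists A.
Qed.

Lemma sqsum0 : sqsum 0 = 0%E.
Proof. by apply: esum1 => x _; rewrite /sqmod /= expr0n addr0. Qed.

Lemma square_summable_submod : submod_closed square_summable.
Proof.
split=> [|c f g]; rewrite !square_summableE ?sqsum0//.
move=> hf hg; rewrite ge0_fin_numE ?sqsum_ge0//.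
apply: le_lt_trans (sqsumD _ _ ltr01) _.
rewrite sqsumZ -ge0_fin_numE; last first.
  by rewrite !adde_ge0// !mule_ge0 ?sqsum_ge0// lee_fin ?sqmod_ge0// ?invr1.
by rewrite fin_numD !fin_numM.
Qed.

HB.instance Definition _ :=
  GRing.isSubmodClosed.Build C (I -> C) square_summable square_summable_submod.

Record l2 := L2 { l2_fun :> I -> C ; l2P : l2_fun \in square_summable }.

HB.instance Definition _ := [isSub for l2_fun].
HB.instance Definition _ := [Choice of l2 by <:].
HB.instance Definition _ := [SubChoice_isSubLmodule of l2 by <:].

Implicit Types u v : l2.

Definition l2norm u : R := Num.sqrt (fine (sqsum u)).

Lemma l2norm_ge0 u : 0 <= l2norm u. Proof. exact: sqrtr_ge0. Qed.

Lemma sqsum_l2norm u : sqsum u = (l2norm u ^+ 2)%:E.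
Proof.
rewrite sqr_sqrtr ?fine_ge0 ?sqsum_ge0// fineK//.
by rewrite -square_summableE l2P.
Qed.

Lemma l2normD u v : l2norm (u + v) <= l2norm u + l2norm v.
Proof.
apply/ler_addgt0Pr => e e0.
set a := l2norm u + e / 2; set b := l2norm v + e / 2.
have e2 : 0 < e / 2 by rewrite divr_gt0.
have a0 : 0 < a by rewrite ltr_wpDl// l2norm_ge0.
have b0 : 0 < b by rewrite ltr_wpDl// l2norm_ge0.
have -> : l2norm u + l2norm v + e = a + b by rewrite /a /b; field.
have a0' := ltW a0; have b0' := ltW b0.
rewrite -(@ler_pXn2r _ 2)// ?nnegrE ?l2norm_ge0//; last exact: addr_ge0.
rewrite -lee_fin -sqsum_l2norm.
have t0 : 0 < b / a by rewrite divr_gt0.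
apply: le_trans (sqsumD _ _ t0) _.
rewrite !sqsum_l2norm -!EFinM -EFinD lee_fin.
have -> : (a + b) ^+ 2 =
    (1 + b / a) * a ^+ 2 + (1 + (b / a)^-1) * b ^+ 2.
  by field; rewrite ?gt_eqF.
apply: lerD; (apply: ler_wpM2l; first by
  rewrite addr_ge0// ?invr_ge0 ltW).
all: by rewrite ler_pXn2r// ?nnegrE ?l2norm_ge0// lerDl ltW.
Qed.

Lemma l2normZ (c : C) u : (l2norm (c *: u))%:C = `|c| * (l2norm u)%:C.
Proof.
rewrite normc_sqmod -rmorphM/=; congr (_ %:C).
rewrite -sqrtrM ?sqmod_ge0//; congr Num.sqrt.
by rewrite sqsumZ fineM// -square_summableE l2P.
Qed.

Lemma l2norm0_eq0 u : l2norm u = 0 -> u = 0.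
Proof.
move=> u0; apply/val_inj/funext => x /=; apply/sqmod0_eq0/eqP.
rewrite eq_le sqmod_ge0 andbT -lee_fin.
have -> : 0%:E = sqsum u by rewrite sqsum_l2norm u0 expr0n.
by apply: esum_ge; exists [set x]; rewrite ?fsbig_set1//; split.
Qed.

Let l2_norm u : C := (l2norm u)%:C.
Let l2_normD u v : l2_norm (u + v) <= l2_norm u + l2_norm v.
Proof. by rewrite -rmorphD/= lecR l2normD. Qed.
Let l2_norm0_eq0 u : l2_norm u = 0 -> u = 0.
Proof. by case=> /l2norm0_eq0. Qed.

HB.instance Definition _ :=
  Lmodule_isNormed.Build C l2 l2_normD l2normZ l2_norm0_eq0.

(* The filter of finite index sets, ordered by inclusion, along which
   unordered sums are limits. *)
Definition finsets : set_system {fset I} :=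
  [set P | exists A, forall B, (A `<=` B)%fset -> P B].

Definition inner u v : C :=
  lim ((\sum_(x <- A) u x * (v x)^* : C^o) @[A --> finsets]).

End SquareSummable.

Section OperatorNorm.
Variables (R : realType) (V W : normedModType (Num.NumField.clone R[i] _)).
Local Notation C := R[i].
Implicit Types f g : V -> W.

Definition opnorm f : R :=
  sup [set complex.Re `|f x| | x in [set x | `|x| <= 1]].

Definition bounded_op f :=
  linear f /\ exists M : R, forall x, `|f x| <= M%:C * `|x|.

Lemma ge0_RReE (z : C) : 0 <= z -> (complex.Re z)%:C = z.
Proof. by move=> /ger0_Im; case: z => a b /= ->. Qed.

Lemma RtoCM (a b : R) : (a * b)%:C = a%:C * b%:C. Proof. exact: rmorphM. Qed.

Lemma RtoCD (a b : R) : (a + b)%:C = a%:C + b%:C. Proof. exact: rmorphD. Qed.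

Lemma normcR (U : normedModType (Num.NumField.clone C _)) (x : U) : `|x| = (complex.Re `|x|)%:C.
Proof. by rewrite ge0_RReE. Qed.

Lemma Re_norm_ge0 (U : normedModType (Num.NumField.clone C _)) (x : U) : 0 <= complex.Re `|x|.
Proof. by rewrite -ler0c -normcR. Qed.

Lemma opnorm_has_sup f : bounded_op f ->
  has_sup [set complex.Re `|f x| | x in [set x | `|x| <= 1]].
Proof.
move=> [_ [M hM]]; split.
  by exists (complex.Re `|f 0|); exists 0 => //=; rewrite normr0.
exists `|M| => _ [x /= x1 <-]; rewrite -lecR -normcR.
apply: le_trans (hM x) _; rewrite [ `|x| ]normcR -RtoCM lecR.
rewrite -[leRHS]mulr1 (le_trans (ler_wpM2r (Re_norm_ge0 x) (ler_norm M)))//.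
by rewrite ler_wpM2l// -lecR -normcR.
Qed.

Lemma opnorm_ge0 f : bounded_op f -> 0 <= opnorm f.
Proof.
move=> bf; apply: le_trans (Re_norm_ge0 (f 0)) _.
by apply: (ub_le_sup (opnorm_has_sup bf).2); exists 0; rewrite //= normr0.
Qed.

Lemma le_opnorm f x : bounded_op f -> `|f x| <= (opnorm f)%:C * `|x|.
Proof.
move=> bf; have [f_lin _] := bf.
pose fL : {linear V -> W} := HB.pack f (GRing.isLinear.Build _ _ _ _ f f_lin).
have [->|x0] := eqVneq x 0.
  by rewrite -[f 0]/(fL 0) linear0 !normr0 mulr0.
have nx : 0 < `|x| by rewrite normr_gt0.
rewrite -ler_pdivrMr// mulrC -[ `|x|^-1 ]ger0_norm ?invr_ge0//.
rewrite -normrZ -[f x]/(fL x) -linearZ [leLHS]normcR lecR.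
apply: (ub_le_sup (opnorm_has_sup bf).2); exists (`|x|^-1 *: x) => //=.
by rewrite normrZ normfV normr_id mulVf// gt_eqF.
Qed.

Lemma opnorm_le f (M : R) : 0 <= M -> bounded_op f ->
  (forall x, `|f x| <= M%:C * `|x|) -> opnorm f <= M.
Proof.
move=> M0 bf hM; apply: ge_sup; first exact: (opnorm_has_sup bf).1.
move=> _ [x /= x1 <-]; rewrite -lecR -normcR (le_trans (hM x))//.
by rewrite -[leRHS]mulr1 ler_wpM2l// lecR.
Qed.

Lemma bounded_opZD (c : C) f g :
  bounded_op f -> bounded_op g -> bounded_op (c *: f + g).
Proof.
move=> [fl [M hM]] [gl [N hN]]; split.
  move=> a x y; rewrite -[LHS]/(c *: f (a *: x + y) + g (a *: x + y)) fl gl.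
  rewrite -[RHS]/(a *: (c *: f x + g x) + (c *: f y + g y)).
  by rewrite !scalerDr !scalerA [c * a]mulrC addrACA.
exists (complex.Re `|c| * M + N) => x.
rewrite (le_trans (ler_normD _ _))// RtoCD mulrDl lerD// RtoCM.
by rewrite normrZ ge0_RReE// -mulrA ler_wpM2l.
Qed.

Lemma bounded_op0 : bounded_op (0 : V -> W).
Proof.
split; first by move=> a x y /=; rewrite scaler0 addr0.
by exists 0 => x; rewrite normr0 mul0r.
Qed.

End OperatorNorm.

Section BoundedOperators.
Variables (R : realType) (V : normedModType (Num.NumField.clone R[i] _)).
Local Notation C := R[i].

Definition bounded_ops : pred (V -> V) := fun f => `[< bounded_op f >].

Lemma bounded_ops_submod : submod_closed bounded_ops.
Proof.
split=> [|c f g /asboolP bf /asboolP bg]; apply/asboolP.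
  exact: bounded_op0.
exact: bounded_opZD.
Qed.

HB.instance Definition _ :=
  GRing.isSubmodClosed.Build C (V -> V) bounded_ops bounded_ops_submod.

Record bop := Bop { bop_fun :> V -> V ; bop_mem : bop_fun \in bounded_ops }.

HB.instance Definition _ := [isSub for bop_fun].
HB.instance Definition _ := [Choice of bop by <:].
HB.instance Definition _ := [SubChoice_isSubLmodule of bop by <:].

Implicit Types A B D : bop.

Lemma bopP A : bounded_op A. Proof. exact/asboolP/bop_mem. Qed.

HB.instance Definition _ A :=
  GRing.isLinear.Build C V V _ (bop_fun A) (bopP A).1.

Lemma bop_ext A B : A =1 B -> A = B.
Proof. by move=> AB; apply/val_inj/funext. Qed.

Lemma bop_one_subproof : (idfun : V -> V) \in bounded_ops.
Proof. by apply/asboolP; split => //; exists 1 => x; rewrite mul1r. Qed.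
Definition bop_one := Bop bop_one_subproof.

Lemma bop_mul_subproof A B : A \o B \in bounded_ops.
Proof.
apply/asboolP; split=> [c x y|]; first by rewrite /= !linearP.
exists (opnorm A * opnorm B) => x /=.
apply: le_trans (le_opnorm _ (bopP A)) _; rewrite RtoCM -mulrA.
by rewrite ler_wpM2l ?lecR ?opnorm_ge0 ?le_opnorm//; exact: bopP.
Qed.
Definition bop_mul A B := Bop (bop_mul_subproof A B).

Fact bop_mulA : associative bop_mul. Proof. by move=> A B D; apply: bop_ext. Qed.
Fact bop_mul1l : left_id bop_one bop_mul.
Proof. by move=> A; apply: bop_ext. Qed.
Fact bop_mul1r : right_id bop_one bop_mul.
Proof. by move=> A; apply: bop_ext. Qed.
Fact bop_mulDl : left_distributive bop_mul +%R.
Proof. by move=> A B D; apply: bop_ext. Qed.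
Fact bop_mulDr : right_distributive bop_mul +%R.
Proof. by move=> A B D; apply: bop_ext => x; exact: (linearD A). Qed.

HB.instance Definition _ := GRing.Zmodule_isPzRing.Build bop
  bop_mulA bop_mul1l bop_mul1r bop_mulDl bop_mulDr.

Let bop_norm A : C := (opnorm A)%:C.
Let bop_normD A B : bop_norm (A + B) <= bop_norm A + bop_norm B.
Proof.
have [[hA hB] hAB] := (bopP A, bopP B, bopP (A + B)).
rewrite -RtoCD lecR; apply: opnorm_le => // [|x].
  by rewrite addr_ge0 ?opnorm_ge0.
rewrite (le_trans (ler_normD _ _))// RtoCD mulrDl.
by rewrite lerD ?le_opnorm.
Qed.
Let bop_normZ_le (c : C) A : bop_norm (c *: A) <= `|c| * bop_norm A.
Proof.
have [hA hcA] := (bopP A, bopP (c *: A)).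
have [k [k0 ck]] : exists k : R, 0 <= k /\ `|c| = k%:C.
  by exists (complex.Re `|c|); rewrite -ler0c ge0_RReE.
rewrite ck -RtoCM lecR; apply: opnorm_le => // [|x].
  by rewrite mulr_ge0 ?opnorm_ge0.
by rewrite normrZ RtoCM ck -mulrA ler_wpM2l ?le_opnorm// ler0c.
Qed.
Let bop_normZ (c : C) A : bop_norm (c *: A) = `|c| * bop_norm A.
Proof.
apply/eqP; rewrite eq_le bop_normZ_le/=.
have [->|c0] := eqVneq c 0.
  by rewrite normr0 mul0r lecR opnorm_ge0//; exact: bopP.
rewrite -ler_pdivlMl ?normr_gt0//.
have := bop_normZ_le c^-1 (c *: A).
by rewrite scalerA mulVf// scale1r normfV.
Qed.
Let bop_norm0_eq0 A : bop_norm A = 0 -> A = 0.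
Proof.
move=> [A0]; apply: bop_ext => x; apply/eqP; rewrite -normr_le0.
by rewrite (le_trans (le_opnorm x (bopP A)))// A0 mul0r.
Qed.

HB.instance Definition _ :=
  Lmodule_isNormed.Build C bop bop_normD bop_normZ bop_norm0_eq0.

End BoundedOperators.

Section AffineSemigroup.

Definition posn := {a : nat | (0 < a)%N}.

Definition posn1 : posn := exist (fun a : nat => (0 < a)%N) 1%N isT.

Fact posn_mul_subproof (a b : posn) : (0 < val a * val b)%N.
Proof. by rewrite muln_gt0 !valP. Qed.

Definition posn_mul (a b : posn) : posn :=
  exist (fun c : nat => (0 < c)%N) (val a * val b)%N (posn_mul_subproof a b).

Definition affine := (nat * posn)%type.

Definition affine_mul (x y : affine) : affine :=
  (x.1 + val x.2 * y.1, posn_mul x.2 y.2)%N.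

Lemma affine_mulI x : injective (affine_mul x).
Proof.
case: x => m a [n b] [n' b'] [/addnI/eqP + /eqP].
by rewrite !eqn_pmul2l ?valP// => /eqP -> /eqP/val_inj ->.
Qed.

Lemma affine_mul1 x : affine_mul (0%N, posn1) x = x.
Proof. by case: x => n b; congr pair; [exact: mul1n|apply/val_inj/mul1n]. Qed.

End AffineSemigroup.

Section ToeplitzAlgebra.
Variable R : realType.
Local Notation C := R[i].
Local Notation H := (l2 R affine).
Implicit Types (x y : affine) (A B : bop H).

Definition adjoint_of A B : Prop := forall u v, inner (A u) v = inner u (B v).

(* The default value 0 is never used: every bounded operator on a Hilbert
   space has a unique adjoint. *)
Definition hadj A : bop H := xget 0 [set B | adjoint_of A B].

(* The sum has at most one term, since left multiplication by y is
   injective: T_y maps the basis vector e_x to e_{yx}. *)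
Definition shift_fun y (f : affine -> C) : affine -> C :=
  fun z => \sum_(x \in [set x | affine_mul y x = z]) f x.

Lemma shift_funE y f x : shift_fun y f (affine_mul y x) = f x.
Proof.
rewrite /shift_fun (_ : [set _ | _] = [set x]) ?fsbig_set1//.
by apply/seteqP; split => z /= => [/affine_mulI|->].
Qed.

Lemma shift_fun0 y f z : ~ range (affine_mul y) z -> shift_fun y f z = 0.
Proof.
move=> yz; rewrite /shift_fun (_ : [set _ | _] = set0) ?fsbig_set0//.
by apply/seteqP; split => // x /= yx; apply: yz; exists x.
Qed.

Lemma sqsum_shift y f : sqsum (shift_fun y f) = sqsum f.
Proof.
rewrite /sqsum (esumID (range (affine_mul y))); last first.
  by move=> z _; rewrite lee_fin sqmod_ge0.
rewrite !setTI [X in (_ + X)%E]esum1 ?adde0; last first.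
  by move=> z /= yz; rewrite shift_fun0// /sqmod /= expr0n addr0.
rewrite esum_image; last by move=> ? ? _ _; exact: affine_mulI.
by apply: eq_esum => x _; rewrite shift_funE.
Qed.

Fact shift_l2_subproof y (u : H) : shift_fun y u \in @square_summable R affine.
Proof. by rewrite square_summableE sqsum_shift -square_summableE l2P. Qed.

Definition shift_l2 y (u : H) : H := L2 (shift_l2_subproof y u).

Fact shift_subproof y : shift_l2 y \in @bounded_ops R H.
Proof.
apply/asboolP; split=> [c u v|].
  apply/val_inj/funext => z /=.
  have [[x _ <-]|yz] := pselect (range (affine_mul y) z).
    rewrite [LHS]shift_funE.
    rewrite -[RHS]/(c * shift_fun y u (affine_mul y x) +
                    shift_fun y v (affine_mul y x)).
    by rewrite !shift_funE.
  rewrite [LHS]shift_fun0//.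
  rewrite -[RHS]/(c * shift_fun y u z + shift_fun y v z).
  by rewrite !shift_fun0// mulr0 addr0.
exists 1 => u; rewrite mul1r -[leLHS]/((l2norm (shift_l2 y u))%:C).
by rewrite /l2norm /= sqsum_shift.
Qed.

Definition shift y : bop H := Bop (shift_subproof y).

Definition cstar_subalgebra (D : set (bop H)) : Prop :=
  [/\ closed D,
      forall c A B, D A -> D B -> D (c *: A + B),
      forall A B, D A -> D B -> D (A * B)
    & forall A, D A -> D (hadj A)].

Definition toeplitz_set : set (bop H) :=
  smallest cstar_subalgebra (range shift).

Definition toeplitz_pred : pred (bop H) := fun A => `[< toeplitz_set A >].

Lemma shift_toeplitz y : shift y \in toeplitz_pred.
Proof. by apply/asboolP; apply: sub_gen_smallest; exact: imageT. Qed.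

Lemma toeplitz_hadj A : A \in toeplitz_pred -> hadj A \in toeplitz_pred.
Proof.
move=> /asboolP tA; apply/asboolP => D DD.
by have [[_ _ _ hD] _] := DD; apply: hD; exact: tA.
Qed.

Lemma toeplitz_subring : subring_closed toeplitz_pred.
Proof.
have h1 : (1 : bop H) = shift (0%N, posn1).
  apply: bop_ext => u; apply/val_inj/funext => z.
  by rewrite /= -{2}(affine_mul1 z) shift_funE.
split=> [|A B /asboolP tA /asboolP tB|A B /asboolP tA /asboolP tB].
- by rewrite h1 shift_toeplitz.
- apply/asboolP => D DD; rewrite addrC -scaleN1r.
  by have [[_ hD _ _] _] := DD; apply: hD; [exact: tB|exact: tA].
- apply/asboolP => D DD.
  by have [[_ _ hD _] _] := DD; apply: hD; [exact: tA|exact: tB].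
Qed.

Lemma toeplitz_submod : submod_closed toeplitz_pred.
Proof.
split=> [|c A B /asboolP tA /asboolP tB].
  by have [h1 hB _] := toeplitz_subring; rewrite -(subrr 1) hB.
apply/asboolP => D DD.
by have [[_ hD _ _] _] := DD; apply: hD; [exact: tA|exact: tB].
Qed.

HB.instance Definition _ :=
  GRing.isSubringClosed.Build (bop H) toeplitz_pred toeplitz_subring.
HB.instance Definition _ :=
  GRing.isSubmodClosed.Build C (bop H) toeplitz_pred toeplitz_submod.

Record toeplitz := Toeplitz {
  toeplitz_op :> bop H ; toeplitzP : toeplitz_op \in toeplitz_pred }.

HB.instance Definition _ := [isSub for toeplitz_op].
HB.instance Definition _ := [Choice of toeplitz by <:].
HB.instance Definition _ := 
  GRing.SubChoice_isSubPzRing.Build (bop H) toeplitz_pred toeplitz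
    (GRing.subringClosedP _).
HB.instance Definition _ := [SubZmodule_isSubLmodule of toeplitz by <:].

Implicit Types c d : toeplitz.

Let toeplitz_norm c : C := `|toeplitz_op c|.
Let toeplitz_normD c d :
  toeplitz_norm (c + d) <= toeplitz_norm c + toeplitz_norm d.
Proof. exact: ler_normD. Qed.
Let toeplitz_normZ (k : C) c :
  toeplitz_norm (k *: c) = `|k| * toeplitz_norm c.
Proof. exact: normrZ. Qed.
Let toeplitz_norm0_eq0 c : toeplitz_norm c = 0 -> c = 0.
Proof. by move=> /normr0_eq0 c0; exact/val_inj. Qed.

HB.instance Definition _ := Lmodule_isNormed.Build C toeplitz
  toeplitz_normD toeplitz_normZ toeplitz_norm0_eq0.

Definition adj c : toeplitz := Toeplitz (toeplitz_hadj (toeplitzP c)).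

Definition Tisom y : toeplitz := Toeplitz (shift_toeplitz y).
Definition s_ : toeplitz := Tisom (1%N, posn1).
Definition v_ (a : posn) : toeplitz := Tisom (0%N, a).

(* s^{((k))}; recall that Negz n is the integer - (n + 1). *)
Definition spow (k : int) : toeplitz :=
  match k with Posz n => s_ ^+ n | Negz n => adj s_ ^+ n.+1 end.

Definition star_automorphism (alpha : toeplitz -> toeplitz) : Prop :=
  [/\ linear alpha, {morph alpha : c d / c * d},
      {morph alpha : c / adj c} & bijective alpha].

(* The scalar is p^{it} = exp (i t ln p). *)
Definition dynamics (sigma : R -> toeplitz -> toeplitz) : Prop :=
  [/\ forall t, star_automorphism (sigma t),
      forall c, sigma 0 c = c
        /\ forall t t', sigma (t + t') c = sigma t (sigma t' c),
      forall c, continuous (fun t => sigma t c)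
    & forall t, sigma t s_ = s_ /\ forall p : posn, prime (val p) ->
        sigma t (v_ p) = (cos (t * ln (val p)%:R) +i* sin (t * ln (val p)%:R))
          *: v_ p].

(* Derivability is over the scalar field R[i], i.e. complex. *)
Definition entire (F : R[i]^o -> toeplitz) : Prop := forall z, derivable F z 1.

Definition entire_extension (sigma : R -> toeplitz -> toeplitz) d
    (F : R[i]^o -> toeplitz) : Prop :=
  entire F /\ forall t : R, F t%:C = sigma t d.

Definition analytic (sigma : R -> toeplitz -> toeplitz) d : Prop :=
  exists F, entire_extension sigma d F.

Definition state (phi : {linear toeplitz -> R[i]^o}) : Prop :=
  (forall c, 0 <= phi (adj c * c)) /\ opnorm phi = 1.

(* F is the unique entire extension of t |-> sigma_t(d), so that
   F (i beta) is sigma_{i beta}(d). *)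
Definition KMS (sigma : R -> toeplitz -> toeplitz) (beta : R)
    (phi : toeplitz -> R[i]^o) : Prop :=
  forall c d F, analytic sigma c -> entire_extension sigma d F ->
    phi (d * c) = phi (c * F (0 +i* beta)).

End ToeplitzAlgebra.

Arguments s_ {R}.
Arguments v_ {R} a.
Arguments spow {R} k.

(* Main.v *)
From HB Require Import structures.
Require Import Defs.
From mathcomp Require Import all_boot all_order all_algebra finmap.
From mathcomp Require Import complex ring lra zify.
From mathcomp Require Import all_classical all_reals all_analysis.

(* Let [g] be a monomial [s^m v_a v_b^* s^{*n}], so that [sigma_t g = e^{itw} g]
   with [w = ln a - ln b].  A KMS state kills [g] unless [w = 0] (pair [g] with
   1), and moving [s^m v_a] past [v_b^* s^{*n}] gives the formula for [a = b].

   Conversely, the formula makes [phi] invariant on monomials, hence everywhere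
   by density, because *-automorphisms are contractive: if [d] is hermitian and
   [|d| < r = |alpha d|], then [r^2 - d^2] is invertible by a Neumann series,
   while [r^2 - (alpha d)^2] is not bounded below.  Invariance gives
   [phi (g sigma_t(d)) = e^{-itw} phi (g d)] for every [d]; if [sigma_t(d)] has
   an entire extension [F], both sides extend and the identity theorem yields
   [phi (g F(i beta)) = e^{beta w} phi (g d)].  So the KMS condition amounts to
   [phi (d g) = e^{beta w} phi (g d)].  This relation is multiplicative in [g]
   and continuous in [d], so it suffices to read it off the formula for [g]
   among [s], [s^*], [v_c], [v_c^*] and [d] a monomial.

   The identity theorem is obtained from Goursat's bisection argument: the mean
   of an entire function over the unit circle, written in logarithmic
   coordinates, is its value at the centre, so that value is controlled by the
   values on the circle. *)

Set Implicit Arguments.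
Unset Strict Implicit.
Unset Printing Implicit Defensive.

Import Order.TTheory GRing.Theory Num.Theory.
Import numFieldNormedType.Exports.

Local Open Scope classical_set_scope.
Local Open Scope ring_scope.
Local Open Scope complex_scope.

(** * Entire functions vanishing on the real line *)

Section RealGoursat.
Variable R : realType.
Implicit Types (f P Q : R -> R) (x y a b : R).

(** [sigma t] is only assumed to be an algebraic *-automorphism, so boundedness of [phi \o sigma t]
    is not given, and without it agreement on monomials would not extend to the closure;
    contractivity supplies it. The KMS condition ranges over all analytic elements, and of an entire
    extension nothing is known but its values on the real line. This calls for an identity theorem
    for functions that are merely complex differentiable at each point: no continuity of the
    derivative is available, hence Goursat rather than Green, and vanishing on the line is carried
    to the point [i beta] by a direct estimate on a circle instead of power series. The adjoint
    [hadj] is a choice with default value 0; it is a true adjoint on the Toeplitz algebra because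
    monomials have explicit adjoints and adjoints pass to norm limits. Products of monomials stay in
    their span because two principal right ideals of the semigroup are either disjoint or meet in a
    principal one. *)

Lemma is_derive_within f df a b :
  (forall x, a <= x <= b -> is_derive x 1 f (df x)) -> {within `[a, b], continuous f}.
Proof.
move=> h; apply: derivable_within_continuous => x; rewrite in_itv/= => axb; by case: (h x axb).
Qed.

Lemma mvt_itv f df a b : a <= b ->
  (forall x, a <= x <= b -> is_derive x 1 f (df x)) ->
  exists2 c, a <= c <= b & f b - f a = df c * (b - a).
Proof.
move=> ab h; have h' x : x \in `]a, b[ -> is_derive x 1 f (df x).
  by rewrite in_itv/= => /andP[/ltW ax /ltW xb]; apply: h; rewrite ax.
have [c] := MVT_segment ab h' (is_derive_within h).
by rewrite in_itv/= => cab ->; exists c.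
Qed.

Lemma mvt_le f df a b (M : R) : a <= b ->
  (forall x, a <= x <= b -> is_derive x 1 f (df x)) ->
  (forall x, a <= x <= b -> `|df x| <= M) -> `|f b - f a| <= M * (b - a).
Proof.
move=> ab h hM; have [c cab ->] := mvt_itv ab h.
by rewrite normrM [ `|b - a|]ger0_norm ?subr_ge0// ler_wpM2r ?subr_ge0 ?hM.
Qed.

Lemma antiderivative_itv f (A : R) : continuous f ->
  exists P, forall x, `|x| < A -> is_derive x 1 P (f x).
Proof.
move=> cf.
exists (fun x => \int[lebesgue_measure]_(t in `[- A, x]) f t).
move=> x /ltr_normlP [xA Ax]; rewrite ltrNl in xA.
have [|||d e] := @continuous_FTC1 R f (BLeft (- A)) x A Ax.
- apply: continuous_compact_integrable; first exact: segment_compact.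
  by apply: continuous_subspaceT => ?; exact: cf.
- by rewrite /= lte_fin.
- exact: cf.
by move: e; rewrite derive1E => e; exact: DeriveDef d e.
Qed.

(** Integration from [- A] only gives primitives on bounded intervals. Normalised to vanish at 0,
    any two of them agree where both are defined, so they glue; near [x] the glued function
    coincides with a single one of them. *)
Lemma antiderivative f : continuous f -> exists P, forall x, is_derive x 1 P (f x).
Proof.
move=> cf; have /choice[P hP] := fun n : nat => antiderivative_itv n%:R cf.
pose n (x : R) := (Num.truncn `|x|).+1.
have hn x : `|x| < (n x)%:R by exact: truncnS_gt.
have PE (N M : nat) x : `|x| < N%:R -> `|x| < M%:R ->
    P N x - P N 0 = P M x - P M 0.
  move=> xN xM.
  have lt0 (K : nat) y : `|x| < K%:R -> `|y| <= `|x| -> is_derive y 1 (P K) (f y).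
    by move=> xK yx; apply: hP; exact: le_lt_trans xK.
  have D y : `|y| <= `|x| -> is_derive y 1 (P N \- P M) 0.
    move=> yx; have := lt0 _ _ xN yx; have := lt0 _ _ xM yx => d1 d2.
    by apply: is_derive_eq; rewrite subrr.
  suff : (P N \- P M) x = (P N \- P M) 0 by rewrite /=; lra.
  have [x0|x0] := leP 0 x.
    have D' y : 0 <= y <= x -> is_derive y 1 (P N \- P M) 0.
      by move=> /andP[y0 yx]; apply: D; rewrite !ger0_norm.
    have [c _] := mvt_itv x0 D'; by rewrite mul0r => /eqP; rewrite subr_eq0 => /eqP.
  have D' y : x <= y <= 0 -> is_derive y 1 (P N \- P M) 0.
    by move=> /andP[yx y0]; apply: D; rewrite !ler0_norm ?lerN2// ltW.
  have [c _] := mvt_itv (ltW x0) D'; by rewrite mul0r => /eqP; rewrite subr_eq0 => /eqP ->.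
exists (fun x => P (n x) x - P (n x) 0) => x.
have [N hN] : exists N : nat, `|x| + 1 < N%:R.
  by exists (Num.bound (`|x| + 1)); rewrite (le_lt_trans _ (archi_boundP _))// addr_ge0.
have xN : `|x| < N%:R by lra.
have := hP N x xN => d.
have d' : is_derive x 1 (fun y => P N y - P N 0) (f x).
  by apply: is_derive_eq; rewrite subr0.
apply: near_eq_is_derive d'.
near=> y; apply: PE => //.
have : `|x - y| < 1 by near: y; apply: (@nbhsx_ballx _ _ x (1 : R)).
have := ler_normB x (x - y); rewrite (_ : x - (x - y) = y); [lra|ring].
Unshelve. all: by end_near.
Qed.

Definition differentiable2 (f : R -> R -> R) p q c1 c2 := forall e, 0 < e ->
  exists2 d, 0 < d & forall x y, `|x - p| < d -> `|y - q| < d ->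
    `|f x y - f p q - c1 * (x - p) - c2 * (y - q)| <= e * (`|x - p| + `|y - q|).

(** * Goursat's theorem for closed forms on rectangles *)

Section Circulation.
Variables (f g PF PG : R -> R -> R).
Hypothesis dPF : forall y x, is_derive x 1 (PF y) (f x y).
Hypothesis dPG : forall x y, is_derive y 1 (PG x) (g x y).
Hypothesis closed : forall p q, exists a b c,
  differentiable2 f p q a c /\ differentiable2 g p q c b.

(** The counterclockwise circulation of [f dx + g dy] around the rectangle with lower left corner
    [(x, y)] and sides [w], [h], with each side integral written through a primitive along that
    side. *)
Let circ (x y w h : R) : R :=
  (PF y (x + w) - PF y x) - (PF (y + h) (x + w) - PF (y + h) x)
  + (PG (x + w) (y + h) - PG (x + w) y) - (PG x (y + h) - PG x y).

(** Opposite sides are estimated together. From top to bottom [f] changes by [- c2 * h], and from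
    left to right [g] changes by [c2 * w], each up to two remainders. The contributions
    [- c2 * h * w] and [c2 * w * h] cancel; this is where the equality of the cross derivatives
    enters. *)
Let circ_local e x y w h p q c1 c2 c3 : 0 <= w -> 0 <= h ->
  x <= p <= x + w -> y <= q <= y + h ->
  (forall x' y', x <= x' <= x + w -> y <= y' <= y + h ->
    `|f x' y' - f p q - c1 * (x' - p) - c2 * (y' - q)| <= e * (w + h)) ->
  (forall x' y', x <= x' <= x + w -> y <= y' <= y + h ->
    `|g x' y' - g p q - c2 * (x' - p) - c3 * (y' - q)| <= e * (w + h)) ->
  `|circ x y w h| <= 2 * e * (w + h) ^+ 2.
Proof.
move=> w0 h0 px qy hf hg.
have xw : x <= x + w by rewrite lerDl.
have yh : y <= y + h by rewrite lerDl.
have DF x' : x <= x' <= x + w ->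
    is_derive x' 1 (fun t => PF y t - PF (y + h) t + c2 * h * t)
      (f x' y - f x' (y + h) + c2 * h).
  move=> _; have d1 := dPF y x'; have d2 := dPF (y + h) x'.
  by apply: is_derive_eq; rewrite -[_ *: 1]/(_ * 1) mulr1.
have DG y' : y <= y' <= y + h ->
    is_derive y' 1 (fun t => PG (x + w) t - PG x t - c2 * w * t)
      (g (x + w) y' - g x y' - c2 * w).
  move=> _; have d1 := dPG (x + w) y'; have d2 := dPG x y'.
  by apply: is_derive_eq; rewrite -[_ *: 1]/(_ * 1) mulr1.
have BF x' : x <= x' <= x + w ->
    `|f x' y - f x' (y + h) + c2 * h| <= 2 * e * (w + h).
  move=> x'P; rewrite (_ : _ + _ = (f x' y - f p q - c1 * (x' - p) - c2 * (y - q))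
    - (f x' (y + h) - f p q - c1 * (x' - p) - c2 * (y + h - q))); last by ring.
  rewrite (le_trans (ler_normB _ _))// -mulrA [2 * _]mulr_natl mulr2n.
  by rewrite lerD// hf// lexx// yh.
have BG y' : y <= y' <= y + h ->
    `|g (x + w) y' - g x y' - c2 * w| <= 2 * e * (w + h).
  move=> y'P; rewrite (_ : _ - _ - _ = (g (x + w) y' - g p q - c2 * (x + w - p) - c3 * (y' - q))
    - (g x y' - g p q - c2 * (x - p) - c3 * (y' - q))); last by ring.
  rewrite (le_trans (ler_normB _ _))// -mulrA [2 * _]mulr_natl mulr2n.
  by rewrite lerD// hg// lexx// xw.
have EF := mvt_le xw DF BF; have EG := mvt_le yh DG BG.
have -> : circ x y w h =
  (PF y (x + w) - PF (y + h) (x + w) + c2 * h * (x + w)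
     - (PF y x - PF (y + h) x + c2 * h * x))
  + (PG (x + w) (y + h) - PG x (y + h) - c2 * w * (y + h)
     - (PG (x + w) y - PG x y - c2 * w * y)) by rewrite /circ; ring.
rewrite (le_trans (ler_normD _ _))//.
rewrite (_ : 2 * e * _ = 2 * e * (w + h) * (x + w - x) + 2 * e * (w + h) * (y + h - y)); last by ring.
exact: lerD.
Qed.

Let circ_quarter x y w h : exists i j : bool,
  `|circ x y w h| <= 4 * `|circ (x + i%:R * (w / 2)) (y + j%:R * (h / 2)) (w / 2) (h / 2)|.
Proof.
set C := fun i j : bool => circ (x + i%:R * (w / 2)) (y + j%:R * (h / 2)) (w / 2) (h / 2).
have E : circ x y w h = C false false + C true false + C false true + C true true.
  rewrite /C /circ !mul0r !mul1r !addr0.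
  rewrite (_ : x + w / 2 + w / 2 = x + w); last by field.
  rewrite (_ : y + h / 2 + h / 2 = y + h); last by field.
  ring.
have [//|] := pselect (exists i j : bool, `|circ x y w h| <= 4 * `|C i j|).
move=> H; exfalso.
have K i j : 4 * `|C i j| < `|circ x y w h|.
  by rewrite ltNge; apply/negP => ?; apply: H; exists i, j.
have := K false false; have := K true false; have := K false true; have := K true true.
have := ler_normD (C false false + C true false + C false true) (C true true).
have := ler_normD (C false false + C true false) (C false true).
have := ler_normD (C false false) (C true false).
rewrite -E; lra.
Qed.

Lemma goursat x y w h : 0 < w -> 0 < h -> circ x y w h = 0.
Proof.
move=> w0 h0; apply/eqP; rewrite -normr_le0; apply/ler_addgt0Pr => e0 e0_gt0; rewrite add0r.
pose W n : R := w / 2 ^+ n; pose H n : R := h / 2 ^+ n.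
have WS n : W n.+1 = W n / 2 by rewrite /W exprSr invfM mulrA.
have HS n : H n.+1 = H n / 2 by rewrite /H exprSr invfM mulrA.
have W_gt0 n : 0 < W n by rewrite divr_gt0// exprn_gt0.
have H_gt0 n : 0 < H n by rewrite divr_gt0// exprn_gt0.
have /choice[S hS] : forall np : nat * (R * R), exists p' : R * R,
  [/\ np.2.1 <= p'.1 /\ p'.1 + W np.1.+1 <= np.2.1 + W np.1,
      np.2.2 <= p'.2 /\ p'.2 + H np.1.+1 <= np.2.2 + H np.1 &
      `|circ np.2.1 np.2.2 (W np.1) (H np.1)|
        <= 4 * `|circ p'.1 p'.2 (W np.1.+1) (H np.1.+1)|].
  move=> [n [a b]] /=; have [i [j ij]] := circ_quarter a b (W n) (H n).
  exists (a + i%:R * (W n / 2), b + j%:R * (H n / 2)) => /=.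
  have Wn := W_gt0 n; have Hn := H_gt0 n.
  by split; [case: (i); rewrite WS/=; lra|case: (j); rewrite HS/=; lra|rewrite WS HS].
pose fix u n : R * R := if n is m.+1 then S (m, u m) else (x, y).
have uS n := hS (n, u n); rewrite /= in uS.
have circ_u n : `|circ x y w h| <= 4 ^+ n * `|circ (u n).1 (u n).2 (W n) (H n)|.
  elim: n => [|n IH]; first by rewrite expr0 mul1r /W /H expr0 !divr1.
  rewrite (le_trans IH)// exprSr -mulrA ler_wpM2l ?exprn_ge0//.
  by have [_ _] := uS n.
(* Nested intervals, applied to each coordinate: the supremum of the left ends lies in all of
   them. *)
have nest (v W' : nat -> R) : (forall n, v n <= v n.+1 /\ v n.+1 + W' n.+1 <= v n + W' n) ->
    (forall n, 0 < W' n) -> exists p, forall n, v n <= p <= v n + W' n.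
  move=> hv W'0.
  have inc m k : v m <= v (m + k)%N.
    by elim: k => [|k IH]; rewrite ?addn0// addnS (le_trans IH)//; have [] := hv (m + k)%N.
  have dec m k : v (m + k)%N + W' (m + k)%N <= v m + W' m.
    elim: k => [|k IH]; rewrite ?addn0// addnS (le_trans _ IH)//.
    by have [] := hv (m + k)%N.
  have vm m n : v m <= v n + W' n.
    have [/subnKC <-|/ltnW/subnKC <-] := leqP m n.
      by rewrite (le_trans (inc m (n - m)%N))// lerDl ltW.
    by rewrite (le_trans _ (dec n (m - n)%N))// lerDl ltW.
  have hsup : has_sup (range v).
    by split; [exists (v 0%N); exists 0%N|exists (v 0%N + W' 0%N) => _ [m _ <-]; exact: vm].
  exists (sup (range v)) => n; apply/andP; split.
    by apply: ub_le_sup; [exact: hsup.2|exists n].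
  apply: ge_sup; first exact: hsup.1.
  by move=> _ [m _ <-]; exact: vm.
have [n|//|p hp] := @nest (fun n => (u n).1) W; first by have [] := uS n.
have [n|//|q hq] := @nest (fun n => (u n).2) H; first by have [] := uS n.
have [c1 [c3 [c2 [df dg]]]] := closed p q.
(* [e] is fixed before the depth [n]: the local bound at depth [n], multiplied by the [4 ^+ n] lost
   through the subdivisions, does not depend on [n]. *)
have [e e_gt0 he] : exists2 e, 0 < e & 2 * e * (w + h) ^+ 2 <= e0.
  exists (e0 / (2 * (w + h) ^+ 2)); first by rewrite divr_gt0 ?mulr_gt0 ?exprn_gt0 ?addr_gt0.
  by rewrite -mulrA mulrCA -mulrA mulVf ?mulr1// gt_eqF// mulr_gt0// exprn_gt0// addr_gt0.
have [d1 d1_gt0 {}df] := df e e_gt0; have [d2 d2_gt0 {}dg] := dg e e_gt0.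
have [n hn] : exists n, (w + h) / 2 ^+ n < Num.min d1 d2.
  have m0 : 0 < Num.min d1 d2 by rewrite lt_min d1_gt0.
  exists (Num.bound ((w + h) / Num.min d1 d2)).
  rewrite ltr_pdivrMr ?exprn_gt0// mulrC -ltr_pdivrMr//.
  exact: upper_nthrootP.
rewrite mulrDl -/(W n) -/(H n) lt_min in hn; case/andP: hn => hd1 hd2.
have Wn := W_gt0 n; have Hn := H_gt0 n.
have pn := hp n; have qn := hq n.
apply: le_trans (circ_u n) _; apply: le_trans he.
have -> : 2 * e * (w + h) ^+ 2 = 4 ^+ n * (2 * e * (W n + H n) ^+ 2).
  rewrite /W /H -mulrDl expr_div_n -exprM mulnC exprM (_ : 2 ^+ 2 = 4); last by rewrite expr2 -natrM.
  by field; rewrite expf_neq0.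
rewrite ler_wpM2l ?exprn_ge0//.
have near1 x' (a b p' : R) : a <= x' <= a + b -> a <= p' <= a + b -> `|x' - p'| <= b.
  by move=> /andP[? ?] /andP[? ?]; rewrite ler_norml; apply/andP; split; lra.
apply: (@circ_local e _ _ _ _ p q c1 c2 c3) => //; try exact: ltW.
  move=> x' y' hx' hy'; have hx := near1 _ _ _ _ hx' pn; have hy := near1 _ _ _ _ hy' qn.
  by rewrite (le_trans (df _ _ _ _))//; [lra|lra|rewrite ler_wpM2l ?lerD// ltW].
move=> x' y' hx' hy'; have hx := near1 _ _ _ _ hx' pn; have hy := near1 _ _ _ _ hy' qn.
by rewrite (le_trans (dg _ _ _ _))//; [lra|lra|rewrite ler_wpM2l ?lerD// ltW].
Qed.

End Circulation.

End RealGoursat.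

Lemma is_derive_epsP (K : numFieldType) (V : normedModType K) (F : K^o -> V) (z : K^o) (l : V) :
  is_derive z 1 F l <->
  forall e : K, 0 < e -> exists2 d : K, 0 < d &
    forall h, `|h| < d -> `|F (z + h) - F z - h *: l| <= e * `|h|.
Proof.
have E (e h : K) : h != 0 ->
    (`|l - h^-1 *: (F (h *: 1 + z) - F z)| <= e) = (`|F (z + h) - F z - h *: l| <= e * `|h|).
  move=> h0; rewrite -(ler_pM2l (_ : 0 < `|h|)) ?normr_gt0// -normrZ scalerBr scalerA mulfV//.
  by rewrite scale1r distrC -[h *: 1]/(h * 1) mulr1 [h + z]addrC [e * _]mulrC.
split=> [[/cvg_ex[l' Fl'] l'l] e e_gt0|H].
  have ll : l' = l by rewrite -l'l; apply/esym/cvg_lim.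
  move: Fl'; rewrite ll => /cvgrPdist_le/(_ _ e_gt0) H.
  have /nbhs_ballP[d /= d_gt0 hd] : \forall h \near (0 : K^o), h != 0 ->
    `|l - h^-1 *: (F (h *: 1 + z) - F z)| <= e by exact: H.
  exists d => // h hd'.
  have [->|h0] := eqVneq h 0; first by rewrite addr0 subrr scale0r subr0 !normr0 mulr0.
  by rewrite -E//; apply: hd h0; rewrite /ball/= sub0r normrN.
have L : h^-1 *: (F (h *: 1 + z) - F z) @[h --> 0^'] --> l.
  apply/cvgrPdist_le => e e_gt0; have [d d_gt0 hd] := H e e_gt0.
  suff : \forall h \near (0 : K^o), h != 0 ->
    `|l - h^-1 *: (F (h *: 1 + z) - F z)| <= e by [].
  apply/nbhs_ballP; exists d => //= h; rewrite /ball/= sub0r normrN => hd' h0.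
  by rewrite E// hd.
by apply: DeriveDef; [apply/cvg_ex; exists l|exact: cvg_lim].
Qed.

(** * Real-valued norms and complex differentiability *)

Section RealNorm.
Variables (R : realType).
Local Notation C := R[i].

(* The norm of a module over [R[i]] takes values in [R[i]]; [cnorm] is its real value. *)
Definition cnorm (V : normedModType (Num.NumField.clone C _)) (x : V) : R := complex.Re `|x|.

Section Normed.
Variable V : normedModType (Num.NumField.clone C _).
Implicit Types x y : V.

Lemma cnormE x : `|x| = (cnorm x)%:C. Proof. exact: normcR. Qed.
Lemma cnorm_ge0 x : 0 <= cnorm x. Proof. exact: Re_norm_ge0. Qed.
Lemma cnorm_le x e : (`|x| <= e%:C) = (cnorm x <= e). Proof. by rewrite cnormE lecR. Qed.
Lemma cnorm_lt x e : (`|x| < e%:C) = (cnorm x < e). Proof. by rewrite cnormE ltcR. Qed.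
Lemma cnormD x y : cnorm (x + y) <= cnorm x + cnorm y.
Proof. by rewrite -lecR -cnormE RtoCD -!cnormE ler_normD. Qed.
Lemma cnormN x : cnorm (- x) = cnorm x. Proof. by rewrite /cnorm normrN. Qed.
Lemma cnormB x y : cnorm (x - y) <= cnorm x + cnorm y.
Proof. by rewrite -(cnormN y) cnormD. Qed.
Lemma cnorm_distC x y : cnorm (x - y) = cnorm (y - x).
Proof. by rewrite -cnormN opprB. Qed.
Lemma cnorm_distD z x y : cnorm (x - y) <= cnorm (x - z) + cnorm (z - y).
Proof. by rewrite (_ : x - y = x - z + (z - y)) ?cnormD// addrA subrK. Qed.
Lemma cnorm0 : cnorm (0 : V) = 0. Proof. by rewrite /cnorm normr0. Qed.
Lemma cnorm0_eq0 x : cnorm x = 0 -> x = 0.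
Proof. by move=> h; apply/normr0_eq0; rewrite cnormE h. Qed.
Lemma cnorm_eq0 x : (cnorm x == 0) = (x == 0).
Proof. by apply/eqP/eqP => [/cnorm0_eq0//|->]; rewrite cnorm0. Qed.
Lemma cnorm_gt0 x : (0 < cnorm x) = (x != 0).
Proof. by rewrite lt_neqAle cnorm_ge0 andbT eq_sym cnorm_eq0. Qed.
End Normed.

Lemma cnormZ (V : normedModType (Num.NumField.clone C _)) (a : C) (x : V) :
  cnorm (a *: x) = cnorm (a : C^o) * cnorm x.
Proof.
apply: (can_inj (fun r : R => erefl : complex.Re r%:C = r)).
by rewrite RtoCM -!cnormE normrZ.
Qed.

Implicit Types z w : C^o.

Lemma cnormM z w : cnorm (z * w : C^o) = cnorm z * cnorm w.
Proof. exact: cnormZ. Qed.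

Lemma cnormX z n : cnorm (z ^+ n : C^o) = cnorm z ^+ n.
Proof.
elim: n => [|n IH]; last by rewrite !exprS -IH -cnormM.
by rewrite !expr0 /cnorm normr1.
Qed.

Lemma cnormC z : cnorm z = Num.sqrt (sqmod z).
Proof. by rewrite /cnorm normc_sqmod. Qed.

Lemma cnorm_real (x : R) : cnorm (x%:C : C^o) = `|x|.
Proof. by rewrite cnormC /sqmod/= expr0n addr0 sqrtr_sqr. Qed.

Lemma cnormRe z : `|complex.Re z| <= cnorm z.
Proof. by rewrite cnormC -sqrtr_sqr ler_sqrt ?sqmod_ge0// lerDl sqr_ge0. Qed.

Lemma cnormIm z : `|complex.Im z| <= cnorm z.
Proof. by rewrite cnormC -sqrtr_sqr ler_sqrt ?sqmod_ge0// lerDr sqr_ge0. Qed.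

Lemma cnorm_ReIm z : cnorm z <= `|complex.Re z| + `|complex.Im z|.
Proof.
rewrite cnormC -(@ler_pXn2r _ 2) ?nnegrE ?sqrtr_ge0 ?addr_ge0// sqr_sqrtr ?sqmod_ge0//.
rewrite /sqmod -[X in X + _]real_normK ?num_real// -[X in _ + X <= _]real_normK ?num_real//.
by have := normr_ge0 (complex.Re z); have := normr_ge0 (complex.Im z); nra.
Qed.

Lemma is_deriveCP (V : normedModType (Num.NumField.clone C _)) (F : C^o -> V) (z : C^o) (l : V) :
  is_derive z 1 F l <->
  forall e : R, 0 < e -> exists2 d : R, 0 < d &
    forall h : C^o, cnorm h < d -> cnorm (F (z + h) - F z - h *: l) <= e * cnorm h.
Proof.
split=> [/is_derive_epsP H e e_gt0|H].
  have [|d d_gt0 hd] := H e%:C; first by rewrite ltcR.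
  exists (complex.Re d); first by case: d d_gt0 {hd} => a b; rewrite ltcE/= => /andP[].
  move=> h hdh; rewrite -lecR RtoCM -!cnormE; apply: hd.
  by rewrite cnormE; move: hdh; rewrite -ltcR (ge0_RReE (ltW d_gt0)).
apply/is_derive_epsP => e e_gt0.
have [|d d_gt0 hd] := H (complex.Re e).
  by case: e e_gt0 => a b; rewrite ltcE/= => /andP[].
exists d%:C; first by rewrite ltcR.
move=> h; rewrite cnorm_lt => /hd; rewrite -lecR RtoCM -!cnormE.
by rewrite (ge0_RReE (ltW e_gt0)).
Qed.

Definition holo (f : C^o -> C^o) := forall z, derivable f z 1.

Lemma holo_comp f g : holo f -> holo g -> holo (fun z => f (g z)).
Proof.
move=> hf hg z; apply/derivable1_diffP; apply: (@differentiable_comp _ _ _ _ g f).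
  exact/derivable1_diffP.
exact/derivable1_diffP.
Qed.
Lemma holoM f g : holo f -> holo g -> holo (fun z => f z * g z).
Proof. by move=> hf hg z; exact: derivableM. Qed.
Lemma holoD f g : holo f -> holo g -> holo (fun z => f z + g z).
Proof. by move=> hf hg z; exact: derivableD. Qed.
Lemma holo_cst (a : C^o) : holo (fun=> a). Proof. by move=> z; exact: derivable_cst. Qed.
Lemma holo_id : holo id. Proof. by move=> z; exact: derivable_id. Qed.
Lemma holoX f n : holo f -> holo (fun z => f z ^+ n).
Proof.
move=> hf; elim: n => [|n IH].
  rewrite (_ : (fun _ => _) = (fun=> 1)); first exact: holo_cst.
  by apply/funext => z; rewrite expr0.
rewrite (_ : (fun _ => _) = (fun z => f z * f z ^+ n)); first exact: (holoM hf IH).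
by apply/funext => z; rewrite exprS.
Qed.

Lemma holo_diff f z : holo f -> exists l : C^o,
  forall e : R, 0 < e -> exists2 d : R, 0 < d &
    forall h : C^o, cnorm h < d -> cnorm (f (z + h) - f z - h * l : C^o) <= e * cnorm h.
Proof.
by move=> hf; have /derivableP/is_deriveCP := hf z; eexists; eassumption.
Qed.

Lemma holo_cont f z : holo f -> forall e : R, 0 < e -> exists2 d : R, 0 < d &
    forall h : C^o, cnorm h < d -> cnorm (f (z + h) - f z) <= e.
Proof.
move=> /(holo_diff z)[l] H e e_gt0; have [d d_gt0 hd] := H 1 ltr01.
have l1 : 0 < 1 + cnorm l by rewrite ltr_pwDl// cnorm_ge0.
exists (Num.min d (e / (1 + cnorm l))); first by rewrite lt_min d_gt0 divr_gt0.
move=> h; rewrite lt_min ltr_pdivlMr// => /andP[/hd h1 h2].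
have := cnormD (f (z + h) - f z - h * l) (h * l : C^o); rewrite subrK cnormM => /le_trans; apply.
by nra.
Qed.

End RealNorm.

Arguments holo_cst {R} a z.
Arguments holo_id {R} z.

(** * The complex exponential and the Cauchy-Riemann equations *)

Section EntireFunctions.
Variable R : realType.
Local Notation C := R[i].
Local Notation cis t := (cos t +i* sin t : C^o).

Definition cexp (z : C^o) : C^o := (expR (complex.Re z))%:C * cis (complex.Im z).

Lemma cexpD z w : cexp (z + w) = cexp z * cexp w.
Proof.
case: z w => [a b] [c d]; rewrite /cexp/= expRD cosD sinD.
by apply/eqP; rewrite eq_complex/=; apply/andP; split; apply/eqP; ring.
Qed.

Lemma real_is_derive_eps (f : R -> R) (x l : R) : is_derive x 1 f l ->
  forall e, 0 < e -> exists2 d, 0 < d &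
    forall h, `|h| < d -> `|f (x + h) - f x - h * l| <= e * `|h|.
Proof. by move=> /is_derive_epsP. Qed.

Lemma is_derive_cexp0 : is_derive (0 : C^o) 1 cexp 1.
Proof.
apply/is_deriveCP => e0 e0_gt0.
(* The real and imaginary remainders will be at most [4 * (e * N)] and [5 * (e * N)], which
   [e0 / 16] absorbs. The second bound contains a term quadratic in [N], linearised by requiring
   [N < e] as well. *)
pose e : R := Num.min 1 (e0 / 16).
have e_gt0 : 0 < e by rewrite lt_min ltr01 divr_gt0.
have e1 : e <= 1 by rewrite ge_min lexx.
have ee0 : e <= e0 / 16 by rewrite ge_min lexx orbT.
clearbody e.
have [d1 d1_gt0 h1] := real_is_derive_eps (is_derive_expR (0 : R)) e_gt0.
have [d2 d2_gt0 h2] := real_is_derive_eps (is_derive_cos (0 : R)) e_gt0.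
have [d3 d3_gt0 h3] := real_is_derive_eps (is_derive_sin (0 : R)) e_gt0.
exists (Num.min (Num.min d1 d2) (Num.min d3 e));
  first by rewrite ![_ < Num.min _ _]lt_min d1_gt0 d2_gt0 d3_gt0 e_gt0.
move=> [x y]; rewrite !lt_min => /andP[/andP[hd1 hd2] /andP[hd3 hde]].
have hx := cnormRe (x +i* y); have hy := cnormIm (x +i* y); rewrite /= in hx hy.
set N := cnorm _ in hd1 hd2 hd3 hde hx hy *.
have {h1} := h1 x (le_lt_trans hx hd1); have {h2} := h2 y (le_lt_trans hy hd2).
have {h3} := h3 y (le_lt_trans hy hd3).
rewrite !add0r expR0 cos0 sin0 !(oppr0, mulr0, addr0, mulr1) => h3 h2 h1.
set E := _ - _; have N0 : 0 <= N := cnorm_ge0 _.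
have h1' : `|expR x - 1 - x| <= e * N. by rewrite (le_trans h1)// ler_pM2l.
have h2' : `|cos y - 1| <= e * N by rewrite (le_trans h2)// ler_pM2l.
have h3' : `|sin y - y| <= e * N by rewrite (le_trans h3)// ler_pM2l.
have RE : complex.Re E = (expR x - 1 - x) + expR x * (cos y - 1).
  rewrite /E /cexp /= !(add0r, expR0, cos0, sin0, scaler0); simpc => /=; ring.
have IE : complex.Im E = (sin y - y) + (expR x - 1) * sin y.
  rewrite /E /cexp /= !(add0r, expR0, cos0, sin0); simpc => /=; ring.
have eN : e * N <= 1 by nra.
have ex3 : `|expR x| <= 3.
  rewrite (_ : expR x = (expR x - 1 - x) + x + 1); last by ring.
  by rewrite (le_trans (ler_normD _ _))// (le_trans (lerD (ler_normD _ _) (lexx _)))// normr1; lra.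
have ex1 : `|expR x - 1| <= 2 * N.
  rewrite (_ : expR x - 1 = (expR x - 1 - x) + x); last by ring.
  by rewrite (le_trans (ler_normD _ _))//; nra.
have sy : `|sin y| <= 2 * N.
  rewrite (_ : sin y = (sin y - y) + y); last by ring.
  by rewrite (le_trans (ler_normD _ _))//; nra.
apply: le_trans (cnorm_ReIm _) _; rewrite RE IE.
have r1 : `|expR x - 1 - x + expR x * (cos y - 1)| <= 4 * (e * N).
  rewrite (le_trans (ler_normD _ _))// normrM.
  have := ler_pM (normr_ge0 _) (normr_ge0 _) ex3 h2'; lra.
have r2 : `|sin y - y + (expR x - 1) * sin y| <= 5 * (e * N).
  rewrite (le_trans (ler_normD _ _))// normrM.
  have := ler_pM (normr_ge0 _) (normr_ge0 _) ex1 sy; nra.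
nra.
Qed.

Lemma holo_cexp : holo cexp.
Proof.
move=> z; suff : is_derive z 1 cexp (cexp z) by case.
apply/is_deriveCP => e e_gt0.
have c1 : 0 < 1 + cnorm (cexp z) by rewrite ltr_pwDl// cnorm_ge0.
have [|d d_gt0 hd] := (is_deriveCP _ _ _).1 is_derive_cexp0 (e / (1 + cnorm (cexp z))).
  exact: divr_gt0.
exists d => // h /hd; rewrite add0r => H.
have e0 : cexp 0 = 1 by rewrite /cexp /= expR0 cos0 sin0 mul1r.
rewrite e0 in H; rewrite cexpD.
have -> : cexp z * cexp h - cexp z - h *: cexp z = cexp z * (cexp h - 1 - h *: (1 : C^o)).
  by rewrite -[h *: cexp z]/(h * cexp z) -[h *: 1]/(h * 1); ring.
rewrite cnormM (le_trans (ler_wpM2l (cnorm_ge0 _) H))// mulrA ler_wpM2r ?cnorm_ge0//.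
by rewrite mulrCA ler_piMr ?ltW// ltr_pdivrMr// mul1r ltrDr.
Qed.

(* Cauchy-Riemann: [v dx + u dy] is closed for [F = u + i v] entire. *)
Lemma cauchy_riemann (F : C^o -> C^o) p q : holo F -> exists a b,
  differentiable2 (fun x y => complex.Im (F (x +i* y))) p q b a /\
  differentiable2 (fun x y => complex.Re (F (x +i* y))) p q a (- b).
Proof.
move=> /(holo_diff (p +i* q))[[a b] H]; exists a, b.
split=> e e_gt0; have [d d_gt0 {H}hd] := H e e_gt0.
all: exists (d / 2); first by rewrite divr_gt0.
all: move=> x y hx hy.
all: have hn := cnorm_ReIm ((x - p) +i* (y - q)); rewrite /= in hn.
all: have {hd} := hd ((x - p) +i* (y - q)).
all: have -> : (p +i* q) + ((x - p) +i* (y - q)) = x +i* y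
       by simpc; rewrite [p + _]addrC [q + _]addrC !subrK.
all: move=> /(_ ltac:(lra)) hd.
- have := cnormIm (F (x +i* y) - F (p +i* q) - ((x - p) +i* (y - q)) * (a +i* b)).
  move=> /le_trans/(_ hd); case: (F (x +i* y)) => u v; case: (F (p +i* q)) => u' v'; simpc => /= h.
  apply: le_trans (le_trans h _); last by rewrite ler_wpM2l// ltW.
  by rewrite le_eqVlt; apply/orP; left; apply/eqP; congr `|_|; ring.
- have := cnormRe (F (x +i* y) - F (p +i* q) - ((x - p) +i* (y - q)) * (a +i* b)).
  move=> /le_trans/(_ hd); case: (F (x +i* y)) => u v; case: (F (p +i* q)) => u' v'; simpc => /= h.
  apply: le_trans (le_trans h _); last by rewrite ler_wpM2l// ltW.
  by rewrite le_eqVlt; apply/orP; left; apply/eqP; congr `|_|; ring.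
Qed.
End EntireFunctions.

(** * Circle means and the identity theorem *)

Section CircleMeans.
Variable R : realType.
Local Notation C := R[i].
Local Notation cis t := (cos t +i* sin t : C^o).

Lemma differentiable2_cont1 (f : R -> R -> R) c1 c2 p q :
  differentiable2 f p q c1 c2 -> {for p, continuous (f^~ q)}.
Proof.
move=> H; have D : is_derive p 1 (f^~ q) c1.
  apply/is_derive_epsP => e e_gt0; have [d d_gt0 hd] := H e e_gt0.
  exists d => // h hd'; have := hd (p + h) q.
  by rewrite [p + h]addrC addrK subrr normr0 mulr0 subr0 addr0 [c1 * h]mulrC => /(_ hd' d_gt0).
by apply/differentiable_continuous/derivable1_diffP; case: D.
Qed.

Lemma differentiable2_cont2 (f : R -> R -> R) c1 c2 p q :
  differentiable2 f p q c1 c2 -> {for q, continuous (f p)}.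
Proof.
move=> H; apply: (@differentiable2_cont1 (fun x y => f y x) c2 c1) => e /H[d d_gt0 hd].
exists d => // x y hx hy; have := hd y x hy hx; rewrite [X in _ <= e * X -> _]addrC; apply: le_trans.
by rewrite le_eqVlt; apply/orP; left; apply/eqP; congr `|_|; ring.
Qed.

Lemma cnorm_cexp (z : C^o) : cnorm (cexp z) = expR (complex.Re z).
Proof.
rewrite /cexp cnormM cnorm_real ger0_norm ?expR_ge0// [X in _ * X]cnormC /sqmod/=.
by rewrite cos2Dsin2 sqrtr1 mulr1.
Qed.

(* In logarithmic coordinates the circle means of [H] are integrals of the
   [2 pi i]-periodic entire function [H \o cexp] over vertical segments. *)
Lemma Re_center_le (H : C^o -> C^o) (M : R) : holo H ->
  (forall t, 0 <= t <= 2 * pi -> cnorm (H (cis t)) <= M) -> `|complex.Re (H 0)| <= M.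
Proof.
move=> hH hM; pose F z := H (cexp z).
have hF : holo F by exact: (holo_comp hH (@holo_cexp R)).
have per x y : F (x +i* (y + 2 * pi)) = F (x +i* y).
  by rewrite /F/= /cexp/= mulr_natl mulr2n; have := (cosD2pi, sinD2pi) => -[-> ->].
set v := fun x y => complex.Im (F (x +i* y)); set u := fun x y => complex.Re (F (x +i* y)).
have CR p q := cauchy_riemann p q hF.
have /choice[PF dPF] : forall y : R, exists P : R -> R, forall x : R, is_derive x 1 P (v x y).
  move=> y; apply: (@antiderivative R (v^~ y)) => x.
  by have [a [b [h _]]] := CR x y; exact: differentiable2_cont1 h.
have /choice[PG dPG] : forall x : R, exists P : R -> R, forall y : R, is_derive y 1 P (u x y).
  move=> x; apply: (@antiderivative R (u x)) => y.
  by have [a [b [_ h]]] := CR x y; exact: differentiable2_cont2 h.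
have pi2 : 0 < 2 * pi :> R by rewrite mulr_gt0// pi_gt0.
apply/ler_addgt0Pr => e e_gt0.
have [d d_gt0 hd] := holo_cont 0 hH e_gt0.
(* Far enough to the left that [cexp] maps the vertical line at [X] into the disc of radius [d]
   around 0, where [H] is within [e] of [H 0]; the [-1] keeps [X] negative. *)
pose X : R := Num.min (-1) (ln (d / 2)).
have X0 : X < 0 by rewrite gt_min ltrN10.
have Xd : expR X < d.
  have d2 : 0 < d / 2 by rewrite divr_gt0.
  have : expR X <= expR (ln (d / 2)) by rewrite ler_expR ge_min lexx orbT.
  rewrite lnK ?posrE//; lra.
have := @goursat R v u PF PG dPF dPG _ X 0 (- X) (2 * pi) _ _.
rewrite !add0r subrr.
(* The horizontal sides cancel by periodicity, so the integrals of [u] over the vertical sides at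
   [0] and at [X] are equal: the first is bounded through [M], the second is nearly [2 * pi] times
   the real part of [H 0]. *)
have -> : (PF 0 0 - PF 0 X) - (PF (2 * pi) 0 - PF (2 * pi) X) = 0.
  have D x : X <= x <= 0 -> is_derive x 1 (fun x => PF 0 x - PF (2 * pi) x) 0.
    move=> _; have d1 := dPF 0 x; have d2 := dPF (2 * pi) x; apply: is_derive_eq.
    by rewrite /v -[2 * pi]add0r per subrr.
  have := mvt_le (M := 0) (ltW X0) D; rewrite normr0 mul0r normr_le0 => /(_ (fun _ _ => lexx _))/eqP.
  by move=> h; rewrite -[RHS]h; ring.
rewrite add0r => G.
have {}G : PG 0 (2 * pi) - PG 0 0 = PG X (2 * pi) - PG X 0.
  apply/eqP; rewrite -subr_eq0; apply/eqP/G => //; last by rewrite oppr_gt0.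
  by move=> p q; have [a [b [h1 h2]]] := CR p q; exists b, (- b), a.
have B1 : `|PG 0 (2 * pi) - PG 0 0| <= M * (2 * pi - 0).
  apply: (mvt_le (ltW pi2) (fun y _ => dPG 0 y)) => y hy.
  by rewrite /u (le_trans (cnormRe _))// /F/= /cexp/= expR0 mul1r; exact: hM.
have B2 : `|(PG X (2 * pi) - complex.Re (H 0) * (2 * pi)) - (PG X 0 - complex.Re (H 0) * 0)|
    <= e * (2 * pi - 0).
  have D y : 0 <= y <= 2 * pi ->
      is_derive y 1 (fun y => PG X y - complex.Re (H 0) * y) (u X y - complex.Re (H 0)).
    move=> _; have d1 := dPG X y; apply: is_derive_eq.
    by rewrite -[_ *: 1]/(_ * 1) mulr1.
  apply: (mvt_le (ltW pi2) D) => y hy.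
  have := hd (cexp (X +i* y)); rewrite cnorm_cexp add0r => /(_ Xd); apply: le_trans.
  rewrite (le_trans _ (cnormRe _))// /u /F/=.
  by case: (H _) => ? ?; case: (H 0) => ? ?; rewrite /=.
have T : `|complex.Re (H 0) * (2 * pi)| <= M * (2 * pi - 0) + e * (2 * pi - 0).
  rewrite (le_trans _ (lerD B1 B2))// G; set a := PG _ _ - PG _ _; rewrite mulr0 subr0.
  set b := _ - PG X 0; have -> : complex.Re (H 0) * (2 * pi) = a - b by rewrite /a /b; ring.
  exact: ler_normB.
by rewrite subr0 -mulrDl normrM [ `|2 * pi|]ger0_norm ?ler_pM2r// ltW in T.
Qed.

(** The imaginary part of [H 0] is the real part of [- i * H 0], so the bound on real parts is used
    twice. The factor 2 is harmless, since the estimate is applied with bounds tending to 0. *)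
Lemma center_le (H : C^o -> C^o) (M : R) : holo H ->
  (forall t, 0 <= t <= 2 * pi -> cnorm (H (cis t)) <= M) -> cnorm (H 0) <= 2 * M.
Proof.
move=> hH hM; rewrite (le_trans (cnorm_ReIm _))// mulr_natl mulr2n lerD ?(Re_center_le hH hM)//.
pose j : C^o := 0 +i* (- 1).
have -> : complex.Im (H 0) = complex.Re (j * H 0).
  by case: (H 0) => a b; rewrite /j/=; ring.
apply: (@Re_center_le (fun z => j * H z)); first exact: (holoM (holo_cst j) hH).
move=> t /hM; rewrite cnormM; congr (_ <= _).
by rewrite [cnorm j]cnormC /sqmod/= expr0n/= sqrrN expr1n add0r sqrtr1 mul1r.
Qed.

(** Only real points need an argument. There the complex derivative can be computed along the axis,
    where [g] vanishes, so it is 0, and [g] agrees with the zero function to first order. *)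
Lemma holo_cut (g : C^o -> C^o) : holo g -> (forall t : R, g t%:C = 0) ->
  holo (fun z => if 0 <= complex.Im z then g z else 0).
Proof.
move=> hg g0 z; have [l Hl] := holo_diff z hg.
have [z0|z0|z0] := ltgtP (complex.Im z) 0.
- suff : is_derive z 1 (fun z => if 0 <= complex.Im z then g z else 0) 0 by case.
  apply/is_deriveCP => e e_gt0; exists (- complex.Im z); first by rewrite oppr_gt0.
  move=> h hd; have := le_lt_trans (cnormIm h) hd; rewrite ltr_norml => /andP[_ hz].
  have -> : (0 <= complex.Im (z + h)) = false.
    by apply/negbTE; rewrite -ltNge; case: (z) (h) hz => ? ? [? ?] /=; lra.
  have -> : (0 <= complex.Im z) = false by apply/negbTE; rewrite -ltNge.
  by rewrite scaler0 !subr0 cnorm0 mulr_ge0 ?cnorm_ge0// ltW.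
- suff : is_derive z 1 (fun z => if 0 <= complex.Im z then g z else 0) l by case.
  apply/is_deriveCP => e e_gt0; have [d d_gt0 hd] := Hl e e_gt0.
  exists (Num.min d (complex.Im z)); first by rewrite lt_min d_gt0.
  move=> h; rewrite lt_min => /andP[h1 h2].
  have := le_lt_trans (cnormIm h) h2; rewrite ltr_norml => /andP[hz _].
  have -> : 0 <= complex.Im (z + h) by case: (z) (h) hz => ? ? [? ?] /=; lra.
  by rewrite (ltW z0) hd.
have zE : z = (complex.Re z)%:C by case: (z) z0 => a b /= ->.
have gz : g z = 0 by rewrite zE g0.
have l0 : l = 0.
  apply/cnorm0_eq0/eqP; rewrite -normr_le0 ger0_norm ?cnorm_ge0//.
  apply/ler_addgt0Pr => e e_gt0; rewrite add0r.
  have [d d_gt0 hd] := Hl e e_gt0.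
  have d2 : 0 < d / 2 by rewrite divr_gt0.
  have := hd (d / 2)%:C; rewrite cnorm_real ger0_norm ?(ltW d2)// => /(_ ltac:(lra)).
  have -> : z + (d / 2)%:C = (complex.Re z + d / 2)%:C by rewrite zE -RtoCD.
  rewrite gz g0 !sub0r !oppr0 sub0r cnormN cnormM.
  by rewrite cnorm_real ger0_norm ?(ltW d2)// mulrC ler_pM2r.
suff : is_derive z 1 (fun z => if 0 <= complex.Im z then g z else 0) 0 by case.
apply/is_deriveCP => e e_gt0; have [d d_gt0 hd] := Hl e e_gt0.
exists d => // h /hd; rewrite l0 mulr0 scaler0 gz z0 lexx !subr0.
by case: ifP => // _ _; rewrite cnorm0 mulr_ge0 ?cnorm_ge0// ltW.
Qed.

Lemma circle_bounded (h : C^o -> C^o) : holo h ->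
  exists M, forall t, 0 <= t <= 2 * pi -> cnorm (h (cis t)) <= M.
Proof.
move=> hh; pose F z := h (cexp z).
have hF : holo F by exact: (holo_comp hh (@holo_cexp R)).
have FE t : F (0 +i* t) = h (cis t) by rewrite /F/= /cexp/= expR0 mul1r.
pose N t : R := `|complex.Re (F (0 +i* t))| + `|complex.Im (F (0 +i* t))|.
have cN : continuous N.
  move=> t; have [a [b [h1 h2]]] := cauchy_riemann 0 t hF.
  by apply: cvgD; apply: cvg_norm; [exact: differentiable2_cont2 h2|exact: differentiable2_cont2 h1].
have pi2 : 0 <= 2 * pi :> R by rewrite mulr_ge0// pi_ge0.
have [c _ hc] := EVT_max pi2 (continuous_subspaceT cN).
exists (N c) => t ht; rewrite -FE (le_trans (cnorm_ReIm _))//.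
by apply: hc; rewrite in_itv.
Qed.

(* Cut [g] off to 0 below the real axis and pull it back by the polynomial
   [P u = i (b + 2 B u + B u^2)], [B = b + 1]: on the unit circle
   [Im (P u) = 2 B x (1 + x) - 1], [x = Re u], is positive only for
   [x >= d = 1 / (4 B)], where [|1 - d u|^2 <= 1 - d^2], so that
   multiplying by [(1 - d u)^n] makes the supremum on the circle tend to 0. *)
Lemma entire_real0 (g : C^o -> C^o) (b : R) : holo g -> (forall t : R, g t%:C = 0) ->
  0 <= b -> g (0 +i* b) = 0.
Proof.
move=> hg g0 b_ge0.
pose h (z : C^o) : C^o := if 0 <= complex.Im z then g z else 0.
have hh : holo h by exact: holo_cut.
pose B : R := b + 1; pose d : R := (4 * B)^-1.
have B_gt0 : 0 < B by rewrite /B; lra.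
have d_gt0 : 0 < d by rewrite invr_gt0 mulr_gt0.
have dB : 4 * B * d = 1 by rewrite mulfV// mulf_neq0// gt_eqF.
have d1 : d <= 1 by rewrite /B in dB; nra.
pose P (z : C^o) : C^o := (0 +i* b) + (0 +i* (2 * B)) * z + (0 +i* B) * z ^+ 2.
pose K (z : C^o) : C^o := 1 + (- d)%:C * z.
have hP : holo P.
  have h1 := holoM (holo_cst (0 +i* (2 * B))) holo_id.
  have h2 := holoM (holo_cst (0 +i* B)) (@holoX R id 2 holo_id).
  exact: (holoD (holoD (holo_cst (0 +i* b)) h1) h2).
have hK : holo K by exact: (holoD (holo_cst 1) (holoM (holo_cst (- d)%:C) holo_id)).
have [M hM] := circle_bounded (holo_comp hh hP).
have M_ge0 : 0 <= M.
  apply: le_trans (cnorm_ge0 _) (hM 0 _); by rewrite lexx mulr_ge0// pi_ge0.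
pose r : R := Num.sqrt (1 - d ^+ 2).
have r_ge0 : 0 <= r by exact: sqrtr_ge0.
have r_lt1 : r < 1 by rewrite -sqrtr1 ltr_sqrt ?ltr01// ltrBlDr ltrDl exprn_gt0.
(* [P 0] is the point [i b] and [K 0 = 1], so the power of [K] leaves the value at the centre
   unchanged while it damps the circle wherever the cut-off function can be nonzero. *)
have main n : cnorm (h (0 +i* b)) <= 2 * (M * r ^+ n).
  have -> : h (0 +i* b) = h (P 0) * K 0 ^+ n.
    by rewrite /P /K !mulr0 expr0n/= mulr0 !addr0 expr1n mulr1.
  apply: (center_le (H := fun z => h (P z) * K z ^+ n)) => [|t ht].
    exact: (holoM (holo_comp hh hP) (@holoX R K n hK)).
  rewrite cnormM; have [hi|hi] := leP 0 (complex.Im (P (cis t))); last first.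
    have -> : h (P (cis t)) = 0 by rewrite /h leNgt hi.
    by rewrite cnorm0 mul0r mulr_ge0// exprn_ge0.
  rewrite ler_pM ?cnorm_ge0 ?hM// cnormX lerXn2r ?nnegrE ?cnorm_ge0//.
  have PE : complex.Im (P (cis t)) = b + 2 * B * cos t + B * (cos t ^+ 2 - sin t ^+ 2).
    by rewrite /P [_ ^+ 2]expr2 /=; ring.
  have KE : sqmod (K (cis t)) = 1 - 2 * d * cos t + d ^+ 2.
    have -> : d ^+ 2 = d ^+ 2 * (cos t ^+ 2 + sin t ^+ 2) by rewrite cos2Dsin2 mulr1.
    by rewrite /K /sqmod /=; ring.
  rewrite cnormC ler_sqrt ?subr_ge0 ?expr_le1 ?(ltW d_gt0)// KE.
  have s2 := cos2Dsin2 t; have c1 := cos_le1 t; rewrite PE /B in hi.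
  (* With [x = cos t], nonnegativity of the imaginary part says [1 <= 2 * B * x * (1 + x)]. Since
     [-1 <= x], this forces [0 < x]; then [1 + x <= 2] gives [1 <= 4 * B * x], which is the origin
     of [d]. *)
  have cd : d <= cos t.
    have q : 1 <= 2 * B * (cos t * (1 + cos t)).
      by rewrite -subr_ge0 (le_trans hi)// le_eqVlt -{2}s2 /B; apply/orP; left; apply/eqP; nra.
    have c0 := cos_geN1 t; rewrite leNgt; apply/negP => ltd.
    have [x0|x0] := leP (cos t) 0.
      have : cos t * (1 + cos t) <= 0 by nra.
      by move=> h3; have := mulr_ge0_le0 (ltW B_gt0) h3; lra.
    have : B * (cos t * (1 + cos t)) <= B * (2 * cos t) by rewrite ler_pM2l//; nra.
    have : B * cos t < B * d by rewrite ltr_pM2l.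
    lra.
  nra.
apply/eqP; rewrite -cnorm_eq0 -normr_le0 ger0_norm ?cnorm_ge0//.
have -> : g (0 +i* b) = h (0 +i* b) by rewrite /h/= b_ge0.
have : (2 * (M * r ^+ n)) @[n --> \oo] --> (2 * (M * 0) : R).
  by apply: cvgMr; apply: cvgMr; apply: cvg_expr; rewrite ger0_norm.
rewrite !mulr0 => cv; apply: (cvgr_to_ge cv); exact: nearW.
Qed.

End CircleMeans.

(** * Inner product, completeness and adjoints *)

Section InnerProduct.
Variables (R : realType) (I : choiceType).
Local Notation C := R[i].
Local Notation H := (l2 R I).
Implicit Types (u v w : H) (A B : {fset I}).

Definition psum (f : I -> C) A : R := \sum_(x <- A) sqmod (f x).

Lemma psum_le (f : I -> C) A : ((psum f A)%:E <= sqsum f)%E.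
Proof.
apply: esum_ge; exists [set` A]; first by split => //; exact: finite_fset.
rewrite fsbig_finite//= set_fsetK /psum -sumEFin.
by rewrite le_eqVlt eqxx.
Qed.

Lemma sqsum_le (f : I -> C) (M : R) : (forall A, psum f A <= M) -> (sqsum f <= M%:E)%E.
Proof.
move=> h; apply: ge_ereal_sup => _ [A [finA _] <-].
by rewrite fsbig_finite//= sumEFin lee_fin; exact: h.
Qed.

Lemma psum_mono (f : I -> C) A B : (A `<=` B)%fset -> psum f A <= psum f B.
Proof.
move=> AB; rewrite /psum [leRHS](big_fsetID _ (mem A))/=.
have -> : [fset x in B | x \in A]%fset = A.
  by apply/fsetP => x; rewrite !inE/= andbC; case: (boolP (x \in A)) => // /(fsubsetP AB) ->.
by rewrite lerDl sumr_ge0// => x _; exact: sqmod_ge0.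
Qed.

Lemma psum_le_norm u A : psum u A <= l2norm u ^+ 2.
Proof. by rewrite -lee_fin -sqsum_l2norm psum_le. Qed.

Lemma psum_cvg u e : 0 < e -> exists A, forall B, (A `<=` B)%fset ->
  l2norm u ^+ 2 - e <= psum u B <= l2norm u ^+ 2.
Proof.
move=> e_gt0; have [A hA] : exists A, l2norm u ^+ 2 - e <= psum u A.
  apply: contrapT => hA; have : (sqsum u <= (l2norm u ^+ 2 - e)%:E)%E.
    by apply: sqsum_le => A; rewrite leNgt; apply/negP => /ltW ?; apply: hA; exists A.
  by rewrite sqsum_l2norm lee_fin lerBrDr gerDl leNgt e_gt0.
by exists A => B AB; rewrite psum_le_norm andbT (le_trans hA)// psum_mono.
Qed.

Definition net_cvg (f : {fset I} -> C^o) (l : C^o) := forall e : R, 0 < e ->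
  exists A, forall B, (A `<=` B)%fset -> cnorm (f B - l) <= e.

Lemma net_cvg_uniq f l l' : net_cvg f l -> net_cvg f l' -> l = l'.
Proof.
move=> h h'; apply/eqP; rewrite -subr_eq0 -(@cnorm_eq0 R C^o) -normr_le0 ger0_norm ?cnorm_ge0//.
apply/ler_addgt0Pr => e e_gt0; rewrite add0r.
have [|A hA] := h (e / 2); first by rewrite divr_gt0.
have [|A' hA'] := h' (e / 2); first by rewrite divr_gt0.
have {}hA := hA (A `|` A')%fset (fsubsetUl _ _).
have {}hA' := hA' (A `|` A')%fset (fsubsetUr _ _).
rewrite (le_trans (cnorm_distD (f (A `|` A')%fset) _ _))// cnorm_distC; lra.
Qed.

Lemma finsets_filter : ProperFilter (@finsets I).
Proof.
apply: Build_ProperFilter_ex; first by move=> P [A /(_ A (fsubset_refl _))]; exists A.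
split; first by exists fset0.
- move=> P Q [A hA] [B hB]; exists (A `|` B)%fset => D AD.
  by split; [apply: hA|apply: hB]; apply: fsubset_trans AD; rewrite ?fsubsetUl ?fsubsetUr.
- by move=> P Q PQ [A hA]; exists A => B /hA/PQ.
Qed.

Lemma net_cvg_lim (f : {fset I} -> C^o) l : net_cvg f l -> lim (f @ @finsets I) = l.
Proof.
move=> h; have FF := finsets_filter; apply: cvg_lim; first exact: norm_hausdorff.
apply/cvgrPdist_le => e e_gt0.
have [|A hA] := h (complex.Re e); first by case: e e_gt0 => a b; rewrite ltcE/= => /andP[].
exists A => B /hA; rewrite -cnorm_le => hB; rewrite distrC (le_trans hB)//.
by rewrite (ge0_RReE (ltW e_gt0)).
Qed.

Lemma net_cvgD f g l l' : net_cvg f l -> net_cvg g l' -> net_cvg (fun A => f A + g A) (l + l').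
Proof.
move=> h h' e e_gt0.
have [|A hA] := h (e / 2); first by rewrite divr_gt0.
have [|B hB] := h' (e / 2); first by rewrite divr_gt0.
exists (A `|` B)%fset => D; rewrite fsubUset => /andP[/hA hA' /hB hB'].
rewrite opprD addrACA (le_trans (cnormD _ _))//; lra.
Qed.

Lemma net_cvgZ (c : C^o) f l : net_cvg f l -> net_cvg (fun A => c * f A) (c * l).
Proof.
move=> h e e_gt0; have c1 : 0 < 1 + cnorm c by rewrite ltr_pwDl// cnorm_ge0.
have [|A hA] := h (e / (1 + cnorm c)); first by rewrite divr_gt0.
exists A => B /hA; rewrite -mulrBr cnormM ler_pdivlMr//; set y := cnorm (_ - _).
have y0 : 0 <= y by exact: cnorm_ge0.
by rewrite mulrDr mulr1 [cnorm c * y]mulrC; apply: le_trans; rewrite lerDr.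
Qed.

Definition form u v A : C^o := \sum_(x <- A) u x * (v x)^*.

Lemma Re_formE u v A :
  complex.Re (form u v A) = (psum (u + v) A - psum u A - psum v A) / 2.
Proof.
rewrite /form /psum raddf_sum -!sumrB mulr_suml; apply: eq_bigr => x _.
rewrite -[(u + v) x]/(u x + v x); case: (u x) (v x) => a b [c d].
by rewrite /sqmod /=; field.
Qed.

Lemma Im_form u v A : complex.Im (form u v A) = complex.Re (form u (Complex 0 1 *: v) A).
Proof.
rewrite /form !raddf_sum; apply: eq_bigr => x _.
by rewrite -[(_ *: v) x]/(_ * v x); case: (u x) (v x) => a b [c d] /=; ring.
Qed.

(** Polarization reduces convergence of the sums [form u v] to that of the sums of squares of [u],
    [v] and [u + v]; this is the resulting value of the real part. The imaginary part follows on
    replacing [v] by [i v]. *)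
Definition Re_inner u v : R := (l2norm (u + v) ^+ 2 - l2norm u ^+ 2 - l2norm v ^+ 2) / 2.

Lemma Re_form_cvg u v e : 0 < e -> exists A, forall B, (A `<=` B)%fset ->
  `|complex.Re (form u v B) - Re_inner u v| <= e.
Proof.
move=> e_gt0.
have [A1 h1] := psum_cvg (u + v) e_gt0; have [A2 h2] := psum_cvg u e_gt0.
have [A3 h3] := psum_cvg v e_gt0.
exists (A1 `|` A2 `|` A3)%fset => B; rewrite !fsubUset => /andP[/andP[AB1 AB2] AB3].
have /andP[h11 h12] := h1 _ AB1; have /andP[h21 h22] := h2 _ AB2.
have /andP[h31 h32] := h3 _ AB3.
rewrite Re_formE /Re_inner ler_norml; apply/andP; split; lra.
Qed.

Lemma innerP u v : net_cvg (form u v) (inner u v).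
Proof.
have H : net_cvg (form u v) (Re_inner u v +i* Re_inner u (Complex 0 1 *: v)).
  move=> e e_gt0; have e2 : 0 < e / 2 by rewrite divr_gt0.
  have [A hA] := Re_form_cvg u v e2; have [B hB] := Re_form_cvg u (Complex 0 1 *: v) e2.
  exists (A `|` B)%fset => D; rewrite fsubUset => /andP[/hA hA' /hB].
  rewrite -Im_form => hB'; rewrite (le_trans (cnorm_ReIm _))//.
  by rewrite [e]splitr lerD//; case: (form u v D) hA' hB'.
by rewrite (net_cvg_lim H : inner u v = _).
Qed.

Lemma innerE u v f : (forall A, f A = form u v A) -> forall l, net_cvg f l -> inner u v = l.
Proof. by move=> /funext -> l; exact/net_cvg_uniq/innerP. Qed.

Lemma inner_lin c u v w : inner (c *: u + v) w = c * inner u w + inner v w.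
Proof.
apply: (innerE _ (net_cvgD (net_cvgZ c (innerP u w)) (innerP v w))) => A.
rewrite /form mulr_sumr -big_split; apply: eq_bigr => x _ /=.
by rewrite mulrA -mulrDl.
Qed.

Lemma inner_conj u v : inner u v = (inner v u)^*%R.
Proof.
apply: (@innerE _ _ (fun A => (form v u A)^*%R)) => [A|].
  by rewrite /form rmorph_sum; apply: eq_bigr => x _; rewrite rmorphM/= conjCK mulrC.
move=> e /(innerP v u)[A hA]; exists A => B /hA; rewrite -rmorphB.
by rewrite /cnorm norm_conjC.
Qed.

Lemma Re_innerE u v : complex.Re (inner u v) = Re_inner u v.
Proof.
apply/eqP; rewrite -subr_eq0 -normr_le0; apply/ler_addgt0Pr => e e_gt0; rewrite add0r.
have e2 : 0 < e / 2 by rewrite divr_gt0.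
have [A hA] := Re_form_cvg u v e2; have [B hB] := innerP u v e2.
have {}hA := hA (A `|` B)%fset (fsubsetUl _ _).
have {}hB := hB (A `|` B)%fset (fsubsetUr _ _).
have := cnormRe (form u v (A `|` B)%fset - inner u v).
case: (form u v _) hA hB => a b; case: (inner u v) => c d /= hA hB /le_trans/(_ hB).
move: hA; rewrite !ler_norml => /andP[? ?] /andP[? ?]; apply/andP; split; lra.
Qed.

Lemma inner_self u : inner u u = (l2norm u ^+ 2)%:C.
Proof.
have hi : complex.Im (inner u u) = 0.
  have := inner_conj u u; case: (inner u u) => a b [] /= h; lra.
have hr : complex.Re (inner u u) = l2norm u ^+ 2.
  rewrite Re_innerE /Re_inner -mulr2n -scaler_nat.
  have : (l2norm (2%:R *: u))%:C = (2%:R * l2norm u)%:C.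
    by rewrite l2normZ RtoCM; congr (_ * _); rewrite normr_nat rmorph_nat.
  by move=> [->]; field.
by move: hi hr; case: (inner u u) => a b /= -> ->.
Qed.

Lemma cnorm_l2 u : cnorm u = l2norm u. Proof. by []. Qed.

(** After polarization, Cauchy-Schwarz for the real part is the square of the triangle
    inequality. *)
Lemma Re_inner_le u v : complex.Re (inner u v) <= cnorm u * cnorm v.
Proof.
rewrite Re_innerE /Re_inner !cnorm_l2.
have := l2normD u v; have := l2norm_ge0 u; have := l2norm_ge0 v; have := l2norm_ge0 (u + v).
nra.
Qed.

Lemma innerNl u v : inner (- u) v = - inner u v.
Proof.
have := inner_lin (-1) u 0 v; rewrite scaleN1r addr0 mulN1r.
by have := inner_lin (-1) 0 0 v; rewrite scaler0 addr0 mulN1r addNr => -> ->; rewrite addr0.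
Qed.

Lemma innerZl c u v : inner (c *: u) v = c * inner u v.
Proof.
have := inner_lin c u 0 v; have := inner_lin (-1) 0 0 v.
by rewrite scaler0 addr0 mulN1r addNr => ->; rewrite !addr0.
Qed.

Lemma innerBl u v w : inner (u - v) w = inner u w - inner v w.
Proof. by have := inner_lin 1 u (- v) w; rewrite scale1r mul1r innerNl. Qed.

Lemma inner_linr c u v w : inner w (c *: u + v) = c^*%R * inner w u + inner w v.
Proof. by rewrite inner_conj inner_lin rmorphD rmorphM/= -!inner_conj. Qed.

Lemma innerBr u v w : inner w (u - v) = inner w u - inner w v.
Proof. by rewrite inner_conj innerBl rmorphB/= -!inner_conj. Qed.

Lemma inner_bound u v : cnorm (inner u v : C^o) <= 2 * (cnorm u * cnorm v).
Proof.
have R1 w z : `|complex.Re (inner w z)| <= cnorm w * cnorm z.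
  rewrite ler_norml Re_inner_le andbT lerNl.
  by have := Re_inner_le (- w) z; rewrite innerNl cnormN; case: (inner w z).
rewrite (le_trans (cnorm_ReIm _))// mulr_natl mulr2n lerD//.
have := R1 (Complex 0 (-1) *: u) v.
rewrite innerZl cnormZ cnormC /sqmod /= expr0n/= sqrrN expr1n add0r sqrtr1 mul1r.
by case: (inner u v) => a b /=; rewrite mul0r mulN1r opprK add0r.
Qed.

Lemma inner_eq u v : (forall w, inner w u = inner w v) -> u = v.
Proof.
move=> h; apply/eqP; rewrite -subr_eq0; apply/eqP/l2norm0_eq0.
have := innerBr u v (u - v); rewrite h subrr inner_self => -[/eqP].
by rewrite sqrf_eq0 => /eqP.
Qed.

End InnerProduct.

(** * Convergent and Cauchy sequences *)

Section Sequences.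
Variables (R : realType) (V : normedModType (Num.NumField.clone R[i] _)).
Implicit Types (u v : nat -> V) (l : V).

Definition cauchy_seq u := forall e : R, 0 < e ->
  exists N, forall n m, (N <= n)%N -> (N <= m)%N -> cnorm (u n - u m) <= e.
Definition seq_cvg u l := forall e : R, 0 < e ->
  exists N, forall n, (N <= n)%N -> cnorm (u n - l) <= e.

Lemma cnorm_eps0 (x : V) : (forall e : R, 0 < e -> cnorm x <= e) -> x = 0.
Proof.
move=> h; apply/cnorm0_eq0/eqP; rewrite -normr_le0 ger0_norm ?cnorm_ge0//.
by apply/ler_addgt0Pr => e /h; rewrite add0r.
Qed.

Lemma seq_cvg_uniq u l l' : seq_cvg u l -> seq_cvg u l' -> l = l'.
Proof.
move=> h h'; apply/eqP; rewrite -subr_eq0; apply/eqP/cnorm_eps0 => e e_gt0.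
have e2 : 0 < e / 2 by rewrite divr_gt0.
have [N hN] := h _ e2; have [M hM] := h' _ e2.
have {}hN := hN _ (leq_maxl N M); have {}hM := hM _ (leq_maxr N M).
rewrite (le_trans (cnorm_distD (u (maxn N M)) _ _))// cnorm_distC; lra.
Qed.

Lemma seq_cvg_cauchy u l : seq_cvg u l -> cauchy_seq u.
Proof.
move=> h e e_gt0; have e2 : 0 < e / 2 by rewrite divr_gt0.
have [N hN] := h _ e2; exists N => n m /hN h1 /hN h2.
rewrite (le_trans (cnorm_distD l _ _))// [cnorm (l - _)]cnorm_distC; lra.
Qed.

Lemma seq_cvg_lin c u v l l' : seq_cvg u l -> seq_cvg v l' ->
  seq_cvg (fun n => c *: u n + v n) (c *: l + l').
Proof.
move=> h h' e e_gt0; have e2 : 0 < e / 2 by rewrite divr_gt0.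
have c1 : 0 < 1 + cnorm (c : R[i]^o) by rewrite ltr_pwDl// cnorm_ge0.
have [|N hN] := h (e / 2 / (1 + cnorm (c : R[i]^o))); first by rewrite divr_gt0.
have [M hM] := h' _ e2.
exists (maxn N M) => n; rewrite geq_max => /andP[/hN + /hM].
rewrite opprD addrACA -scalerBr => h1 h2; rewrite (le_trans (cnormD _ _))// cnormZ.
move: h1; rewrite ler_pdivlMr// => h1.
have : cnorm (c : R[i]^o) * cnorm (u n - l) <= e / 2.
  by apply: le_trans h1; rewrite mulrDr mulr1 mulrC lerDr cnorm_ge0.
lra.
Qed.

End Sequences.

(** * Completeness of the space of square-summable families *)

Section Completeness.
Variables (R : realType) (I : choiceType).
Local Notation C := R[i].
Local Notation H := (l2 R I).

Lemma coord_le (u : H) x : cnorm (u x : C^o) <= cnorm u.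
Proof.
rewrite cnormC cnorm_l2 -(@ler_pXn2r _ 2) ?nnegrE ?sqrtr_ge0 ?l2norm_ge0//.
rewrite sqr_sqrtr ?sqmod_ge0// (le_trans _ (psum_le_norm u [fset x]%fset))//.
by rewrite /psum big_seq_fset1.
Qed.

Lemma cauchy_real (a : nat -> R) : (forall e, 0 < e ->
    exists N, forall n m, (N <= n)%N -> (N <= m)%N -> `|a n - a m| <= e) ->
  exists l : R, a n @[n --> \oo] --> l.
Proof.
move=> h; suff : cvg (a n @[n --> \oo]) by move=> /cvg_ex.
apply/cauchy_cvgP/cauchy_exP => e e_gt0.
have [|N hN] := h (e / 2); first by rewrite divr_gt0.
exists (a N), N => // n /= hn; rewrite /ball/=.
by apply: (@le_lt_trans _ _ (e / 2)); [exact: hN|lra].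
Qed.

Lemma l2_complete (u : nat -> H) : cauchy_seq u -> exists l, seq_cvg u l.
Proof.
move=> cu.
have coordC x e : 0 < e -> exists N, forall n m, (N <= n)%N -> (N <= m)%N ->
    cnorm (u n x - u m x : C^o) <= e.
  move=> e_gt0; have [N hN] := cu _ e_gt0; exists N => n m hn hm.
  exact: le_trans (coord_le (u n - u m) x) (hN _ _ hn hm).
have /choice[a ha] : forall x, exists l : R, complex.Re (u n x) @[n --> \oo] --> l.
  move=> x; apply: cauchy_real => e /(coordC x)[N hN]; exists N => n m hn hm.
  have := le_trans (cnormRe _) (hN _ _ hn hm); by case: (u n x) (u m x) => ? ? [? ?].
have /choice[b hb] : forall x, exists l : R, complex.Im (u n x) @[n --> \oo] --> l.
  move=> x; apply: cauchy_real => e /(coordC x)[N hN]; exists N => n m hn hm.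
  have := le_trans (cnormIm _) (hN _ _ hn hm); by case: (u n x) (u m x) => ? ? [? ?].
pose l x : C := a x +i* b x.
(* Each finite partial sum of the squares of [u n - u m] passes to the limit in [m] coordinatewise,
   so the Cauchy estimate survives with [l] in place of [u m]. *)
have bound (e : R) : 0 < e -> exists N, forall n, (N <= n)%N ->
    (sqsum (fun x => u n x - l x)%R <= (e ^+ 2)%R%:E)%E.
  move=> e_gt0; have [N hN] := cu _ e_gt0; exists N => n hn.
  apply: sqsum_le => A.
  have cv : psum (fun x => u n x - u m x) A @[m --> \oo] --> psum (fun x => u n x - l x) A.
    rewrite /psum; elim: (enum_fset A) => [|x r IH].
      by rewrite big_nil; under eq_fun do rewrite big_nil; exact: cvg_cst.
    rewrite big_cons; under eq_fun do rewrite big_cons; apply: cvgD IH; rewrite /sqmod.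
    have E1 (z w : C) : complex.Re (z - w) = complex.Re z - complex.Re w by case: z w => ? ? [].
    have E2 (z w : C) : complex.Im (z - w) = complex.Im z - complex.Im w by case: z w => ? ? [].
    rewrite E1 E2; under eq_fun do rewrite E1 E2.
    apply: cvgD; (apply: (@cvg_comp _ _ _ _ (fun y => y ^+ 2)); last exact: exprn_continuous).
      by apply: cvgB; [exact: cvg_cst|exact: ha].
    by apply: cvgB; [exact: cvg_cst|exact: hb].
  apply: (cvgr_to_le cv); near=> m.
  have hm : (N <= m)%N by near: m; exact: nbhs_infty_ge.
  apply: le_trans (psum_le_norm (u n - u m) A) _.
  rewrite lerXn2r ?nnegrE ?l2norm_ge0 ?(ltW e_gt0)//; exact: hN.
have [N0 hN0] := bound 1 ltr01.
(* [l] is [u N0] minus the difference just shown to be square-summable. *)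
have sl : l \in @square_summable R I.
  have s1 : (fun x => u N0 x - l x) \in @square_summable R I.
    by apply/asboolP; rewrite (le_lt_trans (hN0 _ (leqnn _)))// ltry.
  have -> : l = (l2_fun (u N0) - (fun x => u N0 x - l x)).
    by apply/funext => x; rewrite -[RHS]/(u N0 x - (u N0 x - l x)) subKr.
  by rewrite rpredB// l2P.
exists (L2 sl) => e e_gt0; have [N hN] := bound _ e_gt0; exists N => n /hN.
rewrite cnorm_l2 => h; rewrite -(@ler_pXn2r _ 2) ?nnegrE ?l2norm_ge0 ?(ltW e_gt0)//.
by rewrite -lee_fin -sqsum_l2norm.
Unshelve. all: by end_near. Qed.

End Completeness.

(** * The Banach algebra of bounded operators *)

Section Operators.
Variables (R : realType) (V : normedModType (Num.NumField.clone R[i] _)).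
Local Notation C := R[i].
Implicit Types (A B : bop V) (x y : V).

Lemma bopB A B x : (A - B) x = A x - B x. Proof. by []. Qed.
Lemma bopZ c A x : (c *: A) x = c *: A x. Proof. by []. Qed.
Lemma bopM A B x : (A * B) x = A (B x). Proof. by []. Qed.
Lemma bop1 x : (1 : bop V) x = x. Proof. by []. Qed.

Lemma cnorm_app A x : cnorm (A x) <= cnorm A * cnorm x.
Proof. by have := le_opnorm x (bopP A); rewrite cnormE [ `|x|]cnormE -RtoCM lecR. Qed.

Lemma cnorm_bop_le A (M : R) : 0 <= M -> (forall x, cnorm (A x) <= M * cnorm x) -> cnorm A <= M.
Proof.
move=> M0 h; apply: (opnorm_le M0 (bopP A)) => x.
by rewrite cnormE [ `|x|]cnormE -RtoCM lecR.
Qed.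

Lemma cnorm_mul A B : cnorm (A * B) <= cnorm A * cnorm B.
Proof.
apply: cnorm_bop_le => [|x]; first by rewrite mulr_ge0 ?cnorm_ge0.
by rewrite -mulrA (le_trans (cnorm_app A _))// ler_wpM2l ?cnorm_ge0 ?cnorm_app.
Qed.

Lemma bop_complete : (forall u : nat -> V, cauchy_seq u -> exists l, seq_cvg u l) ->
  forall A : nat -> bop V, cauchy_seq A -> exists B, seq_cvg A B.
Proof.
move=> complV A cA.
have cAx x : cauchy_seq (fun n => A n x).
  move=> e e_gt0; have x1 : 0 < 1 + cnorm x by rewrite ltr_pwDl// cnorm_ge0.
  have [|N hN] := cA (e / (1 + cnorm x)); first by rewrite divr_gt0.
  exists N => n m hn hm; have := hN _ _ hn hm; rewrite ler_pdivlMr// => h.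
  rewrite -bopB (le_trans (cnorm_app _ _))// (le_trans _ h)// ler_wpM2l ?cnorm_ge0//.
  by rewrite lerDr.
have /choice[B hB] := fun x => complV _ (cAx x).
have linB c x y : B (c *: x + y) = c *: B x + B y.
  apply: seq_cvg_uniq (hB _) _.
  have := seq_cvg_lin c (hB x) (hB y); congr seq_cvg.
  by apply/funext => n; rewrite linearP.
have close e : 0 < e -> exists N, forall n, (N <= n)%N -> forall x,
    cnorm (A n x - B x) <= e * cnorm x.
  move=> e_gt0; have [N hN] := cA _ e_gt0; exists N => n hn x.
  apply/ler_addgt0Pr => d d_gt0; have [M hM] := hB x _ d_gt0.
  have h1 := hM _ (leq_maxr N M).
  have h2 : cnorm (A n x - A (maxn N M) x) <= e * cnorm x.
    rewrite -bopB (le_trans (cnorm_app _ _))// ler_wpM2r ?cnorm_ge0//.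
    by apply: hN => //; exact: leq_maxl.
  by rewrite (le_trans (cnorm_distD (A (maxn N M) x) _ _))// lerD.
have bB : B \in @bounded_ops R V.
  apply/asboolP; split=> //; have [N hN] := close 1 ltr01.
  exists (cnorm (A N) + 1) => x; rewrite cnormE [ `|x|]cnormE -RtoCM lecR mulrDl.
  have := hN _ (leqnn N) x; have := cnorm_app (A N) x.
  have := cnorm_distD (A N x) (B x) 0; rewrite !subr0 [cnorm (B x - _)]cnorm_distC; lra.
exists (Bop bB) => e e_gt0; have [N hN] := close _ e_gt0; exists N => n hn.
by apply: cnorm_bop_le => [|x]; [exact: ltW|exact: hN].
Qed.

End Operators.

(** * Adjoints and hermitian operators *)

Section Adjoint.
Variable R : realType.
Local Notation C := R[i].
Local Notation H := (l2 R affine).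
Implicit Types (A B D : bop H) (u v : H).

Lemma adjoint_uniq A B B' : adjoint_of A B -> adjoint_of A B' -> B = B'.
Proof.
move=> h h'; apply: bop_ext => v; apply: inner_eq => u.
by rewrite -h -h'.
Qed.

Lemma hadj_eq A B : adjoint_of A B -> hadj A = B.
Proof.
move=> h; rewrite /hadj; case: xgetP => [B' _ /= h'|/(_ B)//].
exact: adjoint_uniq h' h.
Qed.

Lemma adjoint_sym A B : adjoint_of A B -> adjoint_of B A.
Proof. by move=> h u v; rewrite inner_conj -h -inner_conj. Qed.

Lemma adjoint_lin c A B A' B' : adjoint_of A B -> adjoint_of A' B' ->
  adjoint_of (c *: A + A') (c^*%R *: B + B').
Proof.
move=> h h' u v; rewrite -[LHS]/(inner (c *: A u + A' u) v).
by rewrite -[RHS]/(inner u (c^*%R *: B v + B' v)) inner_lin inner_linr conjCK h h'.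
Qed.

Lemma adjoint_mul A B A' B' : adjoint_of A B -> adjoint_of A' B' -> adjoint_of (A * A') (B' * B).
Proof. by move=> h h' u v; rewrite !bopM h h'. Qed.

Lemma adjoint0 : adjoint_of (0 : bop H) 0.
Proof.
have A0 : adjoint_of (1 : bop H) 1 by [].
have := adjoint_lin (-1) A0 A0.
by rewrite rmorphN rmorph1 scaleN1r addNr.
Qed.

(* [hadj A] is also 0 when [A] has no adjoint. *)
Lemma adjoint_hadj A : hadj A != 0 -> adjoint_of A (hadj A).
Proof. by rewrite /hadj; case: xgetP => [B _ //|_]; rewrite eqxx. Qed.

Lemma cnorm_self u : (cnorm u ^+ 2)%:C = inner u u.
Proof. by rewrite inner_self. Qed.

Lemma adjoint_cnorm A B : adjoint_of A B -> cnorm B <= cnorm A.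
Proof.
move=> h; apply: cnorm_bop_le => [|v]; first exact: cnorm_ge0.
have [->|B0] := eqVneq (cnorm (B v)) 0; first by rewrite mulr_ge0 ?cnorm_ge0.
have B1 : 0 < cnorm (B v) by rewrite lt_neqAle eq_sym B0 cnorm_ge0.
rewrite -(ler_pM2l B1) -expr2.
have -> : cnorm (B v) ^+ 2 = complex.Re (inner (A (B v)) v) by rewrite h -cnorm_self.
rewrite (le_trans (Re_inner_le _ _))// mulrCA [_ * (_ * cnorm v)]mulrA.
by rewrite ler_wpM2r ?cnorm_ge0 ?cnorm_app// mulrC.
Qed.

(** Passing to the adjoint does not increase the norm, so the adjoints of a convergent sequence are
    again Cauchy. Adjoints on the Toeplitz algebra arise in this way, as limits, without the Riesz
    representation theorem. *)
Lemma adjoint_lim (A B : nat -> bop H) A0 : (forall n, adjoint_of (A n) (B n)) ->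
  seq_cvg A A0 -> exists2 B0, adjoint_of A0 B0 & seq_cvg B B0.
Proof.
move=> h cA.
have hD n m : adjoint_of (A n - A m) (B n - B m).
  have := adjoint_lin (-1) (h m) (h n); rewrite rmorphN rmorph1 !scaleN1r.
  by rewrite addrC [- B m + _]addrC.
have cB : cauchy_seq B.
  move=> e /(seq_cvg_cauchy cA)[N hN]; exists N => n m hn hm.
  exact: le_trans (adjoint_cnorm (hD n m)) (hN _ _ hn hm).
have [B0 hB0] := bop_complete (@l2_complete R affine) cB.
exists B0 => // u v; apply/eqP; rewrite -subr_eq0; apply/eqP.
apply: (@cnorm_eps0 R R[i]^o) => e e_gt0.
pose K := 1 + cnorm u * cnorm v.
have K0 : 0 < K by rewrite ltr_pwDl// mulr_ge0 ?cnorm_ge0.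
have e4 : 0 < e / 4 / K by rewrite !divr_gt0.
have [N hN] := cA _ e4; have [M hM] := hB0 _ e4.
pose n := maxn N M; have {}hN := hN n (leq_maxl _ _); have {}hM := hM n (leq_maxr _ _).
have E : inner (A0 u) v - inner u (B0 v) = inner u ((B n - B0) v) - inner ((A n - A0) u) v.
  by rewrite !bopB innerBr innerBl h; ring.
have uv0 : 0 <= cnorm u * cnorm v by rewrite mulr_ge0 ?cnorm_ge0.
have b1 : cnorm (inner u ((B n - B0) v) : C^o) <= e / 2.
  apply: le_trans (inner_bound _ _) _.
  have := cnorm_app (B n - B0) v; move: hM; rewrite ler_pdivlMr// /K => hM h1.
  have := ler_wpM2l (cnorm_ge0 u) h1; have := cnorm_ge0 (B n - B0); nra.
have b2 : cnorm (inner ((A n - A0) u) v : C^o) <= e / 2.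
  apply: le_trans (inner_bound _ _) _.
  have := cnorm_app (A n - A0) u; move: hN; rewrite ler_pdivlMr// /K => hN h1.
  have := ler_wpM2r (cnorm_ge0 v) h1; have := cnorm_ge0 (A n - A0); nra.
rewrite E (le_trans (cnormB _ _))//; lra.
Qed.

(* Vectors almost attaining the norm of [A] are almost annihilated by [cnorm A ^ 2 - A^2]. *)
Lemma hermitian_not_bounded_below A (d : R) : adjoint_of A A -> 0 < d -> 0 < cnorm A ->
  ~ (forall u, d * cnorm u <= cnorm (((cnorm A ^+ 2)%:C *: (1 : bop H) - A * A) u)).
Proof.
move=> hA d_gt0 A_gt0 hd; set a := cnorm A in A_gt0 hd *.
(* Expanding the square of the norm of [a^2 u - A^2 u] gives the cross term [2 * a^2 * |A u|^2]
   because [A] is hermitian, and the norm of [A^2 u] is at most [a^2 |u|]. *)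
have key u : d ^+ 2 * cnorm u ^+ 2 + 2 * a ^+ 2 * cnorm (A u) ^+ 2 <= 2 * a ^+ 4 * cnorm u ^+ 2.
  pose w := A (A u); pose z := (a ^+ 2)%:C *: u.
  have E : cnorm (z - w) ^+ 2 = a ^+ 4 * cnorm u ^+ 2 + cnorm w ^+ 2 - 2 * a ^+ 2 * cnorm (A u) ^+ 2.
    apply: (can_inj (fun r : R => erefl : complex.Re r%:C = r)).
    rewrite cnorm_self innerBl !innerBr.
    have -> : inner z z = (a ^+ 4 * cnorm u ^+ 2)%:C.
      rewrite -cnorm_self cnormZ cnorm_real ger0_norm ?exprn_ge0 ?(ltW A_gt0)//.
      by congr (_ %:C); ring.
    have -> : inner z w = (a ^+ 2 * cnorm (A u) ^+ 2)%:C.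
      by rewrite innerZl RtoCM cnorm_self /w -hA.
    have -> : inner w z = (a ^+ 2 * cnorm (A u) ^+ 2)%:C.
      rewrite inner_conj innerZl -(hA u (A u)) -cnorm_self -RtoCM.
      by apply/eqP; rewrite eq_complex /= oppr0 !eqxx.
    rewrite -cnorm_self /=; ring.
  have := hd u; rewrite bopB bopZ bopM bop1 -/z -/w => h1.
  have h2 : cnorm w <= a ^+ 2 * cnorm u.
    rewrite (le_trans (cnorm_app _ _))// expr2 -mulrA ler_wpM2l ?(ltW A_gt0)//.
    exact: cnorm_app.
  have h3 : (d * cnorm u) ^+ 2 <= cnorm (z - w) ^+ 2.
    by rewrite lerXn2r ?nnegrE ?cnorm_ge0// mulr_ge0 ?cnorm_ge0 ?(ltW d_gt0).
  have h4 : cnorm w ^+ 2 <= (a ^+ 2 * cnorm u) ^+ 2.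
    by rewrite lerXn2r ?nnegrE ?cnorm_ge0// mulr_ge0 ?cnorm_ge0 ?exprn_ge0 ?(ltW A_gt0).
  move: h3; rewrite E exprMn; move: h4; rewrite exprMn -exprM => h4 h3.
  have -> : 2 * a ^+ 4 * cnorm u ^+ 2 = a ^+ 4 * cnorm u ^+ 2 + a ^+ (2 * 2) * cnorm u ^+ 2 by ring.
  lra.
(* Solved for [cnorm (A u) ^+ 2], [key] bounds it by [b * cnorm u ^+ 2]. As [b < a ^+ 2], the norm
   of [A] would be smaller than itself; the maximum with 0 keeps the square root meaningful should
   [b] be negative. *)
pose b := a ^+ 2 - d ^+ 2 / (2 * a ^+ 2).
have a2 : 0 < a ^+ 2 by rewrite exprn_gt0.
have q_gt0 : 0 < d ^+ 2 / (2 * a ^+ 2) by rewrite divr_gt0 ?exprn_gt0// mulr_gt0.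
have bound u : cnorm (A u) <= Num.sqrt (Num.max b 0) * cnorm u.
  rewrite -(@ler_pXn2r _ 2) ?nnegrE ?mulr_ge0 ?sqrtr_ge0 ?cnorm_ge0//.
  rewrite exprMn [X in _ <= X * _]sqr_sqrtr ?le_max ?lexx ?orbT//.
  apply: (@le_trans _ _ (b * cnorm u ^+ 2)); last first.
    by apply: ler_wpM2r; rewrite ?exprn_ge0 ?cnorm_ge0 ?le_max ?lexx.
  rewrite -(ler_pM2l (_ : 0 < 2 * a ^+ 2)) ?mulr_gt0//.
  have -> : 2 * a ^+ 2 * (b * cnorm u ^+ 2) = 2 * a ^+ 4 * cnorm u ^+ 2 - d ^+ 2 * cnorm u ^+ 2.
    by rewrite /b; field; rewrite gt_eqF.
  by have := key u; lra.
have := cnorm_bop_le (sqrtr_ge0 _) bound; rewrite -/a leNgt => /negP; apply.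
rewrite -(@ltr_pXn2r _ 2) ?nnegrE ?sqrtr_ge0 ?(ltW A_gt0)//.
rewrite sqr_sqrtr ?le_max ?lexx ?orbT// gt_max a2 andbT /b; lra.
Qed.

End Adjoint.

(** * Density of the monomials *)

Section Shifts.
Variable R : realType.
Local Notation C := R[i].
Local Notation H := (l2 R affine).
Local Notation shift := (@Defs.shift R).
Implicit Types (x y z w : affine) (A B D : bop H) (u v : H).

Lemma psum_affine_mul y u (A : {fset affine}) :
  psum (fun x => u (affine_mul y x)) A = psum u (affine_mul y @` A)%fset.
Proof. by rewrite /psum big_imfset//= => ? ? _ _; exact: affine_mulI. Qed.

Fact coshift_l2_subproof y u : (fun x => u (affine_mul y x)) \in @square_summable R affine.
Proof.
apply/asboolP; apply: (@le_lt_trans _ _ (l2norm u ^+ 2)%R%:E); last exact: ltry.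
by apply: sqsum_le => A; rewrite psum_affine_mul psum_le_norm.
Qed.

Definition coshift_l2 y u : H := L2 (coshift_l2_subproof y u).

Fact coshift_subproof y : coshift_l2 y \in @bounded_ops R H.
Proof.
apply/asboolP; split=> [c u v|]; first exact/val_inj/funext.
exists 1 => u; rewrite !cnormE -RtoCM lecR mul1r !cnorm_l2.
rewrite -(@ler_pXn2r _ 2) ?nnegrE ?l2norm_ge0// -lee_fin -sqsum_l2norm.
by apply: sqsum_le => A; rewrite psum_affine_mul psum_le_norm.
Qed.

Definition coshift y : bop H := Bop (coshift_subproof y).

Lemma coshiftE y u x : coshift y u x = u (affine_mul y x). Proof. by []. Qed.

Lemma shiftE y u x : shift y u (affine_mul y x) = u x. Proof. exact: shift_funE. Qed.

Lemma adjoint_shift y : adjoint_of (shift y) (coshift y).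
Proof.
move=> u v; apply/eqP; rewrite -subr_eq0; apply/eqP.
apply: (@cnorm_eps0 R C^o) => e e_gt0; have e2 : 0 < e / 2 by rewrite divr_gt0.
have [D0 hD] := innerP (shift y u) v e2; have [A0 hA] := innerP u (coshift y v) e2.
pose g z := xget z [set x | affine_mul y x = z].
have gK x : g (affine_mul y x) = x.
  by rewrite /g; case: xgetP => [x' _ /affine_mulI//|/(_ x)/(_ erefl)].
pose B := (A0 `|` g @` D0)%fset; pose D := (D0 `|` affine_mul y @` B)%fset.
have {}hA := hA B (fsubsetUl _ _); have {}hD := hD D (fsubsetUl _ _).
have E : form (shift y u) v D = form u (coshift y v) B.
  rewrite /form -(@big_fset_incl _ _ _ _ (affine_mul y @` B)%fset).
  - rewrite big_imfset/=; last by move=> ? ? _ _; exact: affine_mulI.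
    by apply: eq_bigr => x _; congr (_ * _); exact: shiftE.
  - exact: fsubsetUr.
  move=> z zD zB; have [[x _ xz]|yz] := pselect (range (affine_mul y) z); last first.
    by rewrite [shift y u z]shift_fun0// mul0r.
  exfalso; move/negP: zB; apply; rewrite -xz; apply/imfsetP; exists x => //=.
  move: zD; rewrite -xz inE => /orP[zD0|/imfsetP[x' /= + /affine_mulI ->//]].
  by rewrite inE -[in X in _ || X](gK x) in_imfset ?orbT.
rewrite (le_trans (cnorm_distD (form u (coshift y v) B) _ _))//.
by rewrite {1}cnorm_distC -{1}E [e]splitr lerD.
Qed.

Lemma hadj_shift y : hadj (shift y) = coshift y.
Proof. exact/hadj_eq/adjoint_shift. Qed.

Lemma affine_mulA : associative affine_mul.
Proof.
move=> [m a] [n b] [k c]; congr pair => /=; first by rewrite mulnDr addnA mulnA.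
by apply: val_inj; rewrite /= mulnA.
Qed.

Lemma shift_bop_ext A B : (forall u x, A u x = B u x) -> A = B.
Proof. by move=> h; apply: bop_ext => u; apply/val_inj/funext => x; exact: h. Qed.

Lemma shiftM y z : shift y * shift z = shift (affine_mul y z).
Proof.
apply: shift_bop_ext => u x; rewrite bopM.
have [[x' _ <-]|yx] := pselect (range (affine_mul y) x); last first.
  rewrite [LHS]shift_fun0// [RHS]shift_fun0// => -[x' _ xE]; apply: yx.
  by exists (affine_mul z x') => //; rewrite affine_mulA.
rewrite shiftE; have [[w _ <-]|zx] := pselect (range (affine_mul z) x').
  by rewrite shiftE affine_mulA shiftE.
rewrite [LHS]shift_fun0// [RHS]shift_fun0// => -[w _]; rewrite -affine_mulA => /affine_mulI e.
by apply: zx; exists w.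
Qed.

Lemma coshiftM y z : coshift z * coshift y = coshift (affine_mul y z).
Proof. by apply: shift_bop_ext => u x; rewrite bopM !coshiftE affine_mulA. Qed.

Lemma shift1 : shift (0%N, posn1) = 1.
Proof.
apply: shift_bop_ext => u x; rewrite bop1.
by rewrite -{1}(affine_mul1 x) shiftE.
Qed.

Lemma coshift1 : coshift (0%N, posn1) = 1.
Proof. by apply: shift_bop_ext => u x; rewrite bop1 coshiftE affine_mul1. Qed.

Lemma coshift_shift y : coshift y * shift y = 1.
Proof. by apply: shift_bop_ext => u x; rewrite bopM coshiftE shiftE. Qed.

(* The hypotheses say that [y y' = z z'] is a least common right multiple of [y] and [z]. *)
Lemma coshift_shift_lcm y z y' z' : affine_mul y y' = affine_mul z z' ->
  (forall x w, affine_mul y x = affine_mul z w ->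
     exists2 v, x = affine_mul y' v & w = affine_mul z' v) ->
  coshift y * shift z = shift y' * coshift z'.
Proof.
move=> yz h; apply: shift_bop_ext => u x; rewrite !bopM coshiftE.
have [[v _ <-]|yx] := pselect (range (affine_mul y') x).
  by rewrite affine_mulA yz -affine_mulA !shiftE coshiftE.
rewrite [RHS]shift_fun0// [LHS]shift_fun0// => -[w _ wx].
by have [v xv _] := h _ _ (esym wx); apply: yx; exists v.
Qed.

Lemma coshift_shift_disjoint y z : (forall x w, affine_mul y x <> affine_mul z w) ->
  coshift y * shift z = 0.
Proof.
move=> h; apply: shift_bop_ext => u x; rewrite bopM coshiftE [LHS]shift_fun0//.
by move=> [w _ wx]; exact: h (esym wx).
Qed.

(** The semigroup is right LCM, which is what makes a product of two monomials a monomial or 0. The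
    equation [n + b k = l + c j] either has no solution or has a least one, and all others differ
    from it by multiples of [lcmn b c]. *)
Lemma affine_lcm y z : (forall x w, affine_mul y x <> affine_mul z w) \/
  exists y' z', affine_mul y y' = affine_mul z z' /\
  forall x w, affine_mul y x = affine_mul z w -> exists2 v, x = affine_mul y' v & w = affine_mul z' v.
Proof.
case: y z => [n [b b0]] [l [c c0]].
(* Since [c] is positive, any solution [j] is at most [n + b * k]. The bounded search makes [P]
   boolean, so that a least [k] can be chosen. *)
pose P k := [exists j : 'I_(n + b * k).+1, (n + b * k == l + c * j)%N].
have [|noP] := pselect (exists k, P k); last first.
  left=> -[k e] [j f] [h _]; apply: noP; exists k.
  have hj : (j < (n + b * k).+1)%N by rewrite ltnS h (leq_trans _ (leq_addl _ _))// leq_pmull.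
  by apply/existsP; exists (Ordinal hj); rewrite /= h.
move=> exP; right; case: (ex_minnP exP) => k /existsP[j /eqP kj] kmin.
pose L := lcmn b c.
have L0 : (0 < L)%N by rewrite lcmn_gt0 b0.
have b'0 : (0 < L %/ b)%N by rewrite divn_gt0// dvdn_leq// dvdn_lcml.
have c'0 : (0 < L %/ c)%N by rewrite divn_gt0// dvdn_leq// dvdn_lcmr.
have bL : (b * (L %/ b) = L)%N by rewrite mulnC divnK// dvdn_lcml.
have cL : (c * (L %/ c) = L)%N by rewrite mulnC divnK// dvdn_lcmr.
exists (k, exist (fun a : nat => (0 < a)%N) _ b'0), (val j, exist (fun a : nat => (0 < a)%N) _ c'0).
split.
  by congr pair; [exact: kj|apply: val_inj; rewrite /= bL cL].
move=> [x1 [x2 x20]] [w1 [w2 w20]] [h1 h2]; rewrite /= in kj kmin h1 h2.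
have kx : (k <= x1)%N.
  apply: kmin; have hj : (w1 < (n + b * x1).+1)%N.
    by rewrite ltnS h1 (leq_trans _ (leq_addl _ _))// leq_pmull.
  by apply/existsP; exists (Ordinal hj); rewrite /= h1.
have e1 : (b * (x1 - k) = c * (w1 - j))%N.
  by rewrite !mulnBr; lia.
(* The least [k] comes with the least [j], as both sides of the equation grow together. *)
have jw : (j <= w1)%N.
  by rewrite -(leq_pmul2l c0); have := leq_mul (leqnn b) kx; lia.
have /dvdnP[q hq] : (L %| b * (x1 - k))%N by rewrite dvdn_lcm dvdn_mulr//= e1 dvdn_mulr.
have /dvdnP[r hr] : (L %| b * x2)%N by rewrite dvdn_lcm dvdn_mulr//= h2 dvdn_mulr.
have r0 : (0 < r)%N by move: (muln_gt0 b x2); rewrite b0 x20 hr muln_gt0 => /andP[].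
exists (q, exist (fun a : nat => (0 < a)%N) r r0); congr pair => /=.
- apply/eqP; rewrite -(subnKC kx) eqn_add2l -(eqn_pmul2l b0) hq mulnA bL mulnC//.
- by apply: val_inj => /=; apply/eqP; rewrite -(eqn_pmul2l b0) hr mulnA bL mulnC.
- apply/eqP; rewrite -(subnKC jw) eqn_add2l -(eqn_pmul2l c0) -e1 hq mulnA cL mulnC//.
- by apply: val_inj => /=; apply/eqP; rewrite -(eqn_pmul2l c0) -h2 hr mulnA cL mulnC.
Qed.

Lemma coshift_shiftP y z : coshift y * shift z = 0 \/
  exists y' z', affine_mul y y' = affine_mul z z' /\ coshift y * shift z = shift y' * coshift z'.
Proof.
have [/coshift_shift_disjoint|[y' [z' [h1 h2]]]] := affine_lcm y z; [by left|right].
by exists y', z'; split => //; exact: coshift_shift_lcm.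
Qed.

End Shifts.

(** * The norm closure of the span of the monomials *)

Section Density.
Variable R : realType.
Local Notation C := R[i].
Local Notation H := (l2 R affine).
Local Notation shift := (@Defs.shift R).
Local Notation coshift := (@coshift R).
Implicit Types (x y z w : affine) (A B D : bop H) (u v : H).

Inductive monomial_span : bop H -> Prop :=
| monomial_span0 : monomial_span 0
| monomial_spanS c x y A : monomial_span A -> monomial_span (c *: (shift x * coshift y) + A).

Lemma monomial_span1 x y : monomial_span (shift x * coshift y).
Proof. by rewrite -[_ * _]scale1r -[_ *: _]addr0; apply: monomial_spanS monomial_span0. Qed.

Lemma monomial_span_lin c A B : monomial_span A -> monomial_span B -> monomial_span (c *: A + B).
Proof.
move=> hA hB; elim: hA => [|k x y D _ IH]; first by rewrite scaler0 add0r.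
by rewrite scalerDr scalerA -addrA; exact: monomial_spanS.
Qed.

Lemma monomial_span_mul1 x y z w : monomial_span (shift x * coshift y * (shift z * coshift w)).
Proof.
rewrite mulrA -[shift x * _ * _]mulrA.
have [->|[y' [z' [_ ->]]]] := coshift_shiftP R y z.
  by rewrite mulr0 mul0r; exact: monomial_span0.
by rewrite mulrA shiftM -mulrA coshiftM; exact: monomial_span1.
Qed.

Lemma bop_scalerAl (c : C) A B : c *: A * B = c *: (A * B). Proof. exact: bop_ext. Qed.
Lemma bop_scalerAr (c : C) A B : A * (c *: B) = c *: (A * B).
Proof. by apply: bop_ext => u; rewrite bopM !bopZ bopM linearZ. Qed.

Lemma monomial_span_mul A B : monomial_span A -> monomial_span B -> monomial_span (A * B).
Proof.
move=> hA hB; elim: hA => [|k x y D _ IH]; first by rewrite mul0r; exact: monomial_span0.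
rewrite mulrDl bop_scalerAl; apply: monomial_span_lin IH.
elim: hB => [|l z w D' _ IH]; first by rewrite mulr0; exact: monomial_span0.
rewrite mulrDr bop_scalerAr; apply: monomial_span_lin IH; exact: monomial_span_mul1.
Qed.

Lemma adjoint_monomial x y : adjoint_of (shift x * coshift y) (shift y * coshift x).
Proof. by apply: adjoint_mul; [exact: adjoint_shift|exact/adjoint_sym/adjoint_shift]. Qed.

Lemma monomial_span_adjoint A : monomial_span A -> exists2 B, monomial_span B & adjoint_of A B.
Proof.
elim=> [|c x y D _ [B hB hD]]; first by exists 0; [exact: monomial_span0|exact: adjoint0].
exists (c^*%R *: (shift y * coshift x) + B); first exact: monomial_spanS.
exact: adjoint_lin (adjoint_monomial x y) hD.
Qed.

Lemma le_div1D (x k e : R) : 0 <= x -> 0 <= k -> x <= e / (1 + k) -> x * k <= e.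
Proof.
move=> x0 k0; rewrite ler_pdivlMr ?ltr_pwDl// mulrDr mulr1; apply: le_trans.
by rewrite lerDr.
Qed.

Definition approximable (S : set (bop H)) A := forall e : R, 0 < e ->
  exists2 B, S B & cnorm (A - B) <= e.

Lemma closed_approximable (S : set (bop H)) A : closed S -> approximable S A -> S A.
Proof.
move=> cS h; apply: cS => N /nbhs_ballP[e /= e_gt0 he].
have e'_gt0 : 0 < complex.Re e by case: e e_gt0 {he} => a b; rewrite ltcE/= => /andP[].
have [|B SB hB] := h (complex.Re e / 2); first by rewrite divr_gt0.
exists B; split=> //; apply: he; rewrite -ball_normE /= cnormE -(ge0_RReE (ltW e_gt0)) ltcR.
lra.
Qed.

(** The approximable operators themselves form one of the closed *-algebras containing all shifts,
    and [toeplitz_set] is the smallest of these. *)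
Lemma toeplitz_set_approximable A : toeplitz_set A -> approximable monomial_span A.
Proof.
move=> tA; apply: (tA (approximable monomial_span)); split; last first.
  move=> _ [y _ <-] e e_gt0; exists (shift y); last by rewrite subrr cnorm0 ltW.
  by rewrite -[shift y]mulr1 -coshift1; exact: monomial_span1.
split.
- move=> B hB e e_gt0; have e2 : 0 < e / 2 by rewrite divr_gt0.
  have [|B' [/= hB' BB']] := hB (ball B (e / 2)%:C).
    by apply: nbhsx_ballx; rewrite ltcR.
  have [B'' hB'' B'B''] := hB' _ e2; exists B'' => //.
  move: BB'; rewrite -ball_normE /= cnorm_lt => BB'.
  rewrite (le_trans (cnorm_distD B' _ _))//; lra.
- move=> c A1 A2 h1 h2 e e_gt0; have e2 : 0 < e / 2 by rewrite divr_gt0.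
  have c1 : 0 < 1 + cnorm (c : C^o) by rewrite ltr_pwDl// cnorm_ge0.
  have [|B1 hB1 AB1] := h1 (e / 2 / (1 + cnorm (c : C^o))); first by rewrite divr_gt0.
  have [B2 hB2 AB2] := h2 _ e2.
  exists (c *: B1 + B2); first exact: monomial_span_lin.
  rewrite opprD addrACA -scalerBr (le_trans (cnormD _ _))// cnormZ.
  by rewrite [e]splitr lerD// mulrC le_div1D ?cnorm_ge0.
- move=> A1 A2 h1 h2 e e_gt0; have e2 : 0 < e / 2 by rewrite divr_gt0.
  have c2 : 0 < 1 + cnorm A2 by rewrite ltr_pwDl// cnorm_ge0.
  have [|B1 hB1 AB1] := h1 (e / 2 / (1 + cnorm A2)); first by rewrite divr_gt0.
  have c1 : 0 < 1 + cnorm B1 by rewrite ltr_pwDl// cnorm_ge0.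
  have [|B2 hB2 AB2] := h2 (e / 2 / (1 + cnorm B1)); first by rewrite divr_gt0.
  exists (B1 * B2); first exact: monomial_span_mul.
  have -> : A1 * A2 - B1 * B2 = (A1 - B1) * A2 + B1 * (A2 - B2).
    by rewrite mulrBl mulrBr addrA; rewrite subrK.
  rewrite (le_trans (cnormD _ _))//.
  rewrite [e]splitr; apply: lerD; apply: le_trans (cnorm_mul _ _) _.
    by rewrite le_div1D ?cnorm_ge0.
  by rewrite mulrC le_div1D ?cnorm_ge0.
(* At this stage [hadj A1] might still be the default value 0, which lies in the span; a nonzero
   [hadj A1] is a true adjoint. *)
move=> A1 h1 e e_gt0; have [->|A10] := eqVneq (hadj A1) 0.
  by exists 0; [exact: monomial_span0|rewrite subrr cnorm0 ltW].
have [B hB AB] := h1 _ e_gt0; have [B' hB' BB'] := monomial_span_adjoint hB.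
exists B' => //; apply: le_trans AB; apply: adjoint_cnorm.
have := adjoint_lin (-1) BB' (adjoint_hadj A10).
by rewrite rmorphN rmorph1 !scaleN1r ![- _ + _]addrC.
Qed.

Lemma approximable_seq (S : set (bop H)) A : approximable S A ->
  exists2 B : nat -> bop H, (forall n, S (B n)) & seq_cvg B A.
Proof.
move=> h; have e_gt0 n : 0 < (n.+1%:R)^-1 :> R by rewrite invr_gt0.
have /choice[B hB] : forall n, exists B, S B /\ cnorm (A - B) <= (n.+1%:R)^-1 :> R.
  by move=> n; have [B ? ?] := h _ (e_gt0 n); exists B.
exists B => [n|e e0]; first exact: (hB n).1.
exists (Num.truncn e^-1) => n hn; rewrite cnorm_distC (le_trans (hB n).2)//.
rewrite -[e]invrK lef_pV2 ?posrE ?invr_gt0//.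
by rewrite (le_trans (ltW (truncnS_gt _)))// ler_nat ltnS.
Qed.

(** Sums of monomials have adjoints and these pass to the limit, so on the Toeplitz algebra [hadj]
    never falls back on its default. *)
Lemma toeplitz_set_adjoint A : toeplitz_set A -> adjoint_of A (hadj A).
Proof.
move=> /toeplitz_set_approximable/approximable_seq[B hB cB].
have /choice[B' hB'] : forall n, exists B', adjoint_of (B n) B'.
  by move=> n; have [B' _ ?] := monomial_span_adjoint (hB n); exists B'.
by have [A' hA _] := adjoint_lim hB' cB; rewrite (hadj_eq hA).
Qed.

Lemma toeplitz_set_closed A : approximable (@toeplitz_set R) A -> toeplitz_set A.
Proof.
move=> h D DD; have [[cD _ _ _] _] := DD; apply: (closed_approximable cD) => e /h[B tB AB].
by exists B => //; exact: tB.
Qed.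

End Density.

(** * Automorphisms and dynamics *)

Section Toeplitz.
Variable R : realType.
Local Notation C := R[i].
Local Notation H := (l2 R affine).
Local Notation T := (toeplitz R).
Local Notation shift := (@Defs.shift R).
Local Notation coshift := (@coshift R).
Implicit Types (x y z w : affine) (c d e : T).

Lemma toeplitz_inj : injective (@toeplitz_op R). Proof. exact: val_inj. Qed.

Lemma toeplitz_opM c d : toeplitz_op (c * d) = toeplitz_op c * toeplitz_op d. Proof. by []. Qed.
Lemma toeplitz_opB c d : toeplitz_op (c - d) = toeplitz_op c - toeplitz_op d. Proof. by []. Qed.
Lemma toeplitz_opD c d : toeplitz_op (c + d) = toeplitz_op c + toeplitz_op d. Proof. by []. Qed.
Lemma toeplitz_opZ k c : toeplitz_op (k *: c) = k *: toeplitz_op c. Proof. by []. Qed.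
Lemma toeplitz_op1 : toeplitz_op (1 : T) = 1. Proof. by []. Qed.
Lemma cnorm_toeplitz c : cnorm c = cnorm (toeplitz_op c). Proof. by []. Qed.

Lemma toeplitz_mem c : toeplitz_set (toeplitz_op c). Proof. exact/asboolP/toeplitzP. Qed.

Lemma toeplitz_scalerAl (k : C) c d : k *: c * d = k *: (c * d).
Proof. by apply: toeplitz_inj; rewrite toeplitz_opM !toeplitz_opZ bop_scalerAl. Qed.
Lemma toeplitz_scalerAr (k : C) c d : c * (k *: d) = k *: (c * d).
Proof. by apply: toeplitz_inj; rewrite toeplitz_opM !toeplitz_opZ bop_scalerAr. Qed.

Lemma toeplitz_cnormM c d : cnorm (c * d) <= cnorm c * cnorm d.
Proof. exact: cnorm_mul. Qed.

Lemma adjP c : adjoint_of (toeplitz_op c) (toeplitz_op (adj c)).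
Proof. exact: (toeplitz_set_adjoint (toeplitz_mem c)). Qed.

Lemma adj_eq c d : adjoint_of (toeplitz_op c) (toeplitz_op d) -> adj c = d.
Proof. by move=> h; apply: toeplitz_inj; apply: adjoint_uniq (adjP c) h. Qed.

Lemma adjM c d : adj (c * d) = adj d * adj c.
Proof. exact/adj_eq/(adjoint_mul (adjP c) (adjP d)). Qed.

Lemma adjK c : adj (adj c) = c.
Proof. exact/adj_eq/adjoint_sym/adjP. Qed.

Lemma adjZ k c : adj (k *: c) = k^*%R *: adj c.
Proof.
by apply: adj_eq; have := adjoint_lin k (adjP c) (@adjoint0 R); rewrite !addr0.
Qed.

Lemma adj1 : adj (1 : T) = 1.
Proof. exact: adj_eq. Qed.

Lemma adjX c n : adj (c ^+ n) = adj c ^+ n.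
Proof. by elim: n => [|n IH]; rewrite ?expr0 ?adj1// [in LHS]exprS adjM IH [RHS]exprSr. Qed.

Lemma adj_cnorm c : cnorm (adj c) <= cnorm c.
Proof. exact: adjoint_cnorm (adjP c). Qed.

Lemma adj_Tisom_op y : toeplitz_op (adj (Tisom R y)) = coshift y.
Proof. exact: hadj_shift. Qed.

Lemma cstar_identity c : cnorm c ^+ 2 <= cnorm (adj c * c).
Proof.
rewrite -(@sqr_sqrtr _ (cnorm (adj c * c))) ?cnorm_ge0//.
rewrite lerXn2r ?nnegrE ?cnorm_ge0 ?sqrtr_ge0//.
apply: cnorm_bop_le => [|u]; first exact: sqrtr_ge0.
rewrite -(@ler_pXn2r _ 2) ?nnegrE ?mulr_ge0 ?sqrtr_ge0 ?cnorm_ge0//.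
rewrite exprMn [X in _ <= X * _]sqr_sqrtr ?cnorm_ge0//.
have -> : cnorm (toeplitz_op c u) ^+ 2 = complex.Re (inner u ((adj c * c : T) u)).
  by rewrite toeplitz_opM bopM -adjP -cnorm_self.
rewrite (le_trans (Re_inner_le _ _))// mulrC expr2 mulrA ler_wpM2r ?cnorm_ge0//.
exact: cnorm_app.
Qed.

Lemma toeplitz_complete (u : nat -> T) : cauchy_seq u -> exists l, seq_cvg u l.
Proof.
move=> cu; have [B hB] := bop_complete (@l2_complete R affine)
  (cu : cauchy_seq (fun n => toeplitz_op (u n))).
have tB : toeplitz_set B.
  apply: toeplitz_set_closed => e /hB[N hN]; exists (toeplitz_op (u N)); first exact: toeplitz_mem.
  by rewrite cnorm_distC; exact: hN.
by exists (Toeplitz (asboolT tB)).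
Qed.

(** A left inverse is what the contractivity argument calls for: [d * (1 - c) = 1] makes the
    operator [1 - c] bounded below, and the relation is preserved by automorphisms. *)
Lemma neumann c : cnorm c < 1 -> exists d, d * (1 - c) = 1.
Proof.
move=> c1; pose r := cnorm c; pose u n := \sum_(i < n) c ^+ i.
have r0 : 0 <= r := cnorm_ge0 c.
have [K K1] : exists K : R, cnorm (1 : T) <= K by exists (cnorm (1 : T)).
have K0 : 0 <= K := le_trans (cnorm_ge0 _) K1.
have cX n : cnorm (c ^+ n) <= K * r ^+ n.
  elim: n => [|n IH]; first by rewrite !expr0 mulr1.
  rewrite exprSr (le_trans (toeplitz_cnormM _ _))// exprSr mulrA ler_wpM2r//.
have r1 : 0 < 1 - r by rewrite subr_gt0.
(* The sharper bound with [r ^+ n - r ^+ (n + k)] telescopes, which is why the induction goes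
   through it. *)
have uD n k : cnorm (u (n + k)%N - u n) <= K / (1 - r) * r ^+ n.
  have : cnorm (u (n + k)%N - u n) <= K / (1 - r) * (r ^+ n - r ^+ (n + k)).
    elim: k => [|k IH]; first by rewrite addn0 !subrr cnorm0 mulr0.
    rewrite /u addnS big_ord_recr/= -/(u _) addrAC (le_trans (cnormD _ _))//.
    rewrite (le_trans (lerD IH (cX _)))// le_eqVlt exprS; apply/orP; left; apply/eqP.
    by field; rewrite gt_eqF.
  move=> /le_trans; apply; rewrite ler_wpM2l ?divr_ge0 ?(ltW r1)//.
  by rewrite gerBl exprn_ge0.
have un n : u n * (1 - c) = 1 - c ^+ n.
  elim: n => [|n IH]; first by rewrite /u big_ord0 mul0r expr0 subrr.
  by rewrite /u big_ord_recr/= -/(u n) mulrDl IH mulrBr mulr1 -exprSr addrA subrK.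
clearbody u.
have rn (e : R) : 0 < e -> exists N, forall n, (N <= n)%N -> r ^+ n <= e.
  move=> e0; have : r ^+ n @[n --> \oo] --> (0 : R) by apply: cvg_expr; rewrite ger0_norm.
  move=> /cvgrPdist_le/(_ e e0)[N _ hN]; exists N => n hn.
  by have := hN n hn; rewrite sub0r normrN; apply: le_trans; exact: ler_norm.
have KR : 0 <= K / (1 - r) by rewrite divr_ge0// ltW.
have cu : cauchy_seq u.
  move=> e e_gt0; have [|N hN] := rn (e / 2 / (1 + K / (1 - r))).
    by rewrite !divr_gt0// ltr_pwDl.
  have uN n : (N <= n)%N -> cnorm (u n - u N) <= e / 2.
    move=> /subnKC <-; apply: le_trans (uD _ _) _; rewrite mulrC le_div1D ?exprn_ge0//.
    exact: hN.
  exists N => n m /uN hn /uN hm; rewrite (le_trans (cnorm_distD (u N) _ _))//.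
  rewrite [e]splitr; apply: lerD; first exact: hn.
  rewrite cnorm_distC; exact: hm.
have [d hd] := toeplitz_complete cu; exists d.
apply/eqP; rewrite -subr_eq0; apply/eqP/cnorm_eps0 => e e_gt0.
have e2 : 0 < e / 2 by rewrite divr_gt0.
have [|N hN] := hd (e / 2 / (1 + cnorm (1 - c))).
  by rewrite divr_gt0// ltr_pwDl// cnorm_ge0.
have [|M hM] := rn (e / 2 / (1 + K)); first by rewrite divr_gt0// ltr_pwDl.
pose n := maxn N M; have {}hN := hN n (leq_maxl _ _); have {}hM := hM n (leq_maxr _ _).
have -> : d * (1 - c) - 1 = - ((u n - d) * (1 - c)) - c ^+ n.
  rewrite mulrBl un; move: (d * (1 - c)) (c ^+ n) => X Y.
  by rewrite !opprB -addrA [Y - 1]addrC addrK.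
rewrite (le_trans (cnormB _ _))// cnormN [e]splitr; apply: lerD.
  by rewrite (le_trans (toeplitz_cnormM _ _))// le_div1D ?cnorm_ge0.
by rewrite (le_trans (cX _))// mulrC le_div1D ?exprn_ge0.
Qed.

Lemma le_of_le_div (p k z n : R) : 0 < p -> 0 <= k -> 0 <= z ->
  n <= k * (p^-1 * z) -> p / (1 + k) * n <= z.
Proof.
move=> p0 k0 z0 h; have k1 : 0 < 1 + k by lra.
rewrite mulrAC ler_pdivrMr// (le_trans (ler_wpM2l (ltW p0) h))//.
by rewrite mulrCA mulVKf ?gt_eqF// mulrC ler_wpM2l// lerDr.
Qed.

Lemma hermitian_contractive (alpha : T -> T) d : star_automorphism alpha -> adj d = d ->
  cnorm (alpha d) <= cnorm d.
Proof.
move=> [lin mult star bij] dd; rewrite leNgt; apply/negP => ltd.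
set a := cnorm (alpha d) in ltd; have a_gt0 : 0 < a := le_lt_trans (cnorm_ge0 _) ltd.
pose aL : {linear T -> T} := HB.pack alpha (GRing.isLinear.Build _ _ _ _ alpha lin).
(* Unitality is not part of [star_automorphism]; it follows from multiplicativity and
   surjectivity. *)
have a1 : alpha 1 = 1.
  have [beta ab ba] := bij; rewrite -[LHS]mulr1 -[X in _ * X]ba -mult mul1r ba//.
pose x := (a ^- 2)%:C *: (d * d).
have x1 : cnorm x < 1.
  rewrite cnormZ cnorm_real ger0_norm ?invr_ge0 ?exprn_ge0 ?(ltW a_gt0)//.
  rewrite mulrC ltr_pdivrMr ?exprn_gt0// mul1r (le_lt_trans (toeplitz_cnormM _ _))//.
  by rewrite -expr2 ltrXn2r ?nnegrE ?cnorm_ge0// ltW.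
have [y hy] := neumann x1.
have hA : adjoint_of (toeplitz_op (alpha d)) (toeplitz_op (alpha d)).
  by have := adjP (alpha d); rewrite -star dd.
pose K := cnorm (alpha y).
have K1 : 0 < 1 + K by apply: ltr_pwDl; [exact: ltr01|exact: cnorm_ge0].
(* From [alpha y * (1 - alpha x) = 1], the vector [u] is [alpha y] applied to [a^-2 Z]. This bounds
   [a^2 u] by [K] times the norm of [Z]; [1 + K] replaces [K] to avoid dividing by 0. *)
apply: (hermitian_not_bounded_below hA (divr_gt0 (exprn_gt0 2 a_gt0) K1) a_gt0) => u.
rewrite -[cnorm (toeplitz_op _)]/a; set Z := bop_fun (_ - _) u.
have E : u = toeplitz_op (alpha y) ((a ^- 2)%:C *: Z).
  have : toeplitz_op (alpha y * (1 - alpha x)) u = u.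
    have -> : alpha y * (1 - alpha x) = 1.
      transitivity (alpha (y * (1 - x))); last by rewrite hy.
      rewrite mult; congr (_ * _).
      by have := linearB aL 1 x; rewrite /= a1 => ->.
    by [].
  rewrite toeplitz_opM bopM => {1}<-; congr (bop_fun _ _).
  rewrite toeplitz_opB bopB toeplitz_op1 bop1 /x -[alpha (_ *: _)]/(aL (_ *: _)) linearZ /= mult.
  rewrite /Z bopB scalerBr bopZ bop1 scalerA -RtoCM mulVf ?scale1r//.
  by rewrite expf_neq0// gt_eqF.
have : cnorm u <= K * (a ^- 2 * cnorm Z).
  rewrite {1}E (le_trans (cnorm_app _ _))// cnormZ cnorm_real ger0_norm//.
  by rewrite invr_ge0 exprn_ge0// ltW.
exact: le_of_le_div (exprn_gt0 2 a_gt0) (cnorm_ge0 _) (cnorm_ge0 _).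
Qed.

End Toeplitz.

(** * Bounded functionals and eigenvectors of the dynamics *)

Section Dynamics.
Variable R : realType.
Local Notation C := R[i].
Local Notation T := (toeplitz R).
Local Notation Tisom := (@Tisom R).
Implicit Types (x y : affine) (c d : T) (w : R).

(** The C*-identity reduces the claim to the hermitian element [adj c * c]. *)
Lemma automorphism_contractive (alpha : T -> T) c : star_automorphism alpha ->
  cnorm (alpha c) <= cnorm c.
Proof.
move=> ha; have [lin mult star bij] := ha.
rewrite -(@ler_pXn2r _ 2) ?nnegrE ?cnorm_ge0//.
apply: le_trans (cstar_identity _) _; rewrite -star -mult.
have dd : adj (adj c * c) = adj c * c by rewrite adjM adjK.
apply: le_trans (hermitian_contractive ha dd) _.
apply: le_trans (toeplitz_cnormM _ _) _; rewrite expr2; apply: ler_wpM2r; first exact: cnorm_ge0.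
exact: adj_cnorm.
Qed.

Definition monomial x y : T := Tisom x * adj (Tisom y).

Lemma monomial_op x y : toeplitz_op (monomial x y) = Defs.shift R x * coshift R y.
Proof. by rewrite toeplitz_opM adj_Tisom_op. Qed.

Definition bounded_functional (f : T -> C^o) :=
  (forall (k : C) c d, f (k *: c + d) = k * f c + f d) /\
  exists M : R, forall c, cnorm (f c) <= M * cnorm c.

Lemma functional_eq0 (f : T -> C^o) : bounded_functional f ->
  (forall x y, f (monomial x y) = 0) -> forall c, f c = 0.
Proof.
move=> [lin [M hM]] f0 c; apply: cnorm_eps0 => e e_gt0.
have lin0 : f 0 = 0.
  have := lin (-1) 0 0; rewrite scaler0 addr0 mulN1r addNr //.
have spanP B : monomial_span B -> exists2 d : T, toeplitz_op d = B & f d = 0.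
  elim=> [|k x y A _ [d <- fd]]; first by exists 0.
  exists (k *: monomial x y + d); last by rewrite lin f0 mulr0 fd addr0.
  by rewrite toeplitz_opD toeplitz_opZ monomial_op.
have M1 : 0 < 1 + `|M| by apply: ltr_pwDl; [exact: ltr01|exact: normr_ge0].
have [|B /spanP[d dB fd] cB] := toeplitz_set_approximable (toeplitz_mem c) (e := e / (1 + `|M|)).
  exact: divr_gt0.
have -> : f c = f (c - d).
  have := lin (-1) d c; rewrite fd mulr0 add0r scaleN1r addrC => <-//.
apply: le_trans (hM _) _; apply: (@le_trans _ _ (`|M| * cnorm (c - d))).
  by apply: ler_wpM2r; [exact: cnorm_ge0|exact: ler_norm].
rewrite mulrC; apply: le_div1D; [exact: cnorm_ge0|exact: normr_ge0|].
by rewrite cnorm_toeplitz toeplitz_opB dB.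
Qed.

Lemma functional_ext (f g : T -> C^o) : bounded_functional f -> bounded_functional g ->
  (forall x y, f (monomial x y) = g (monomial x y)) -> f =1 g.
Proof.
move=> [linf [M hM]] [ling [N hN]] fg c; apply/eqP; rewrite -subr_eq0; apply/eqP.
apply: (@functional_eq0 (fun c => f c - g c)); last by move=> x y; rewrite fg subrr.
split=> [k a b|]; first by rewrite linf ling; ring.
exists (M + N) => a; rewrite (le_trans (cnormB _ _))// mulrDl; apply: lerD; [exact: hM|exact: hN].
Qed.

Lemma bounded_comp (f : T -> C^o) (g : T -> T) (K : R) : bounded_functional f ->
  (forall (k : C) c d, g (k *: c + d) = k *: g c + g d) ->
  (forall c, cnorm (g c) <= K * cnorm c) -> bounded_functional (fun c => f (g c)).
Proof.
move=> [lin [M hM]] ling hg; split=> [k a b|]; first by rewrite ling lin.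
exists (`|M| * K) => c; rewrite -mulrA; apply: le_trans (hM _) _.
apply: (@le_trans _ _ (`|M| * cnorm (g c))).
  by apply: ler_wpM2r; [exact: cnorm_ge0|exact: ler_norm].
by apply: ler_wpM2l; [exact: normr_ge0|exact: hg].
Qed.

Lemma bounded_mull (f : T -> C^o) d : bounded_functional f ->
  bounded_functional (fun c => f (d * c)).
Proof.
move=> bf; apply: (bounded_comp (K := cnorm d) bf) => [k a b|c].
  by rewrite mulrDr toeplitz_scalerAr.
exact: toeplitz_cnormM.
Qed.

Lemma bounded_mulr (f : T -> C^o) d : bounded_functional f ->
  bounded_functional (fun c => f (c * d)).
Proof.
move=> bf; apply: (bounded_comp (K := cnorm d) bf) => [k a b|c].
  by rewrite mulrDl toeplitz_scalerAl.
by rewrite mulrC; exact: toeplitz_cnormM.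
Qed.

Lemma bounded_scale (f : T -> C^o) (k : C) : bounded_functional f ->
  bounded_functional (fun c => k * f c).
Proof.
move=> [lin [M hM]]; split=> [l a b|]; first by rewrite lin mulrDr !mulrA [k * l]mulrC.
exists (cnorm (k : C^o) * M) => c; rewrite -[_ * f c]/(k *: f c) cnormZ -mulrA.
by apply: ler_wpM2l; [exact: cnorm_ge0|exact: hM].
Qed.

Lemma state_bounded (phi : {linear T -> C^o}) : state phi -> bounded_functional phi.
Proof.
move=> [_ phi1]; split=> [k c d|]; first by rewrite linearP.
pose S := [set complex.Re `|phi x| | x in [set x : T | `|x| <= 1]].
(* [sup] is 0 on a set that has no supremum, so [opnorm phi = 1] does force the values on the unit
   ball to be bounded. *)
have supS : has_sup S.
  by apply: contrapT => /sup_out; rewrite -[sup S]/(opnorm phi) phi1 => /eqP; rewrite oner_eq0.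
exists 1 => c; rewrite mul1r.
have [->|c0] := eqVneq c 0; first by rewrite linear0 !cnorm0.
have nc : 0 < cnorm c by rewrite cnorm_gt0.
pose k : C := (cnorm c)^-1%:C.
have cnk : cnorm (k : C^o) = (cnorm c)^-1 by rewrite cnorm_real ger0_norm// invr_ge0 ltW.
have : cnorm (phi (k *: c)) <= 1.
  rewrite -[leRHS]phi1; apply: (ub_le_sup supS.2); exists (k *: c) => //=.
  by rewrite [ `|_|]cnormE cnormZ cnk mulVf ?gt_eqF.
rewrite linearZ /= -[_ *: phi c]/(k *: phi c) cnormZ cnk mulrC ler_pdivrMr//.
by rewrite mul1r.
Qed.

Lemma cexp0 : cexp (0 : C^o) = 1.
Proof. by rewrite /cexp /= expR0 cos0 sin0 mul1r. Qed.

Lemma cexp_conj t : (cexp (0 +i* t : C^o))^*%R = cexp (0 +i* - t : C^o) :> C.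
Proof.
rewrite /cexp /= expR0 !mul1r cosN sinN.
by [].
Qed.

Variable sigma : R -> T -> T.
Hypothesis dyn : dynamics sigma.

Let aut t : star_automorphism (sigma t). Proof. by have [h _ _ _] := dyn; exact: h. Qed.
Let sigmaM t : {morph sigma t : c d / c * d}. Proof. by have [] := aut t. Qed.
Let sigma_adj t : {morph sigma t : c / adj c}. Proof. by have [] := aut t. Qed.

Lemma dynamics1 t : sigma t 1 = 1.
Proof.
have [lin mult _ [g ab ba]] := aut t.
by rewrite -[LHS]mulr1 -[X in _ * X]ba -mult mul1r ba.
Qed.

Definition weighted c (w : R) := forall t, sigma t c = cexp (0 +i* (t * w)) *: c.

Lemma weightedM c d w w' : weighted c w -> weighted d w' -> weighted (c * d) (w + w').
Proof.
move=> h h' t; rewrite sigmaM h h' toeplitz_scalerAl toeplitz_scalerAr scalerA.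
by rewrite -cexpD; congr (cexp _ *: _); rewrite mulrDr; apply/eqP; rewrite eq_complex /= addr0 !eqxx.
Qed.

Lemma weighted_adj c w : weighted c w -> weighted (adj c) (- w).
Proof. by move=> h t; rewrite sigma_adj h adjZ cexp_conj mulrN. Qed.

Lemma weighted1 : weighted 1 0.
Proof. by move=> t; rewrite dynamics1 mulr0 cexp0 scale1r. Qed.

Lemma TisomM x y : Tisom x * Tisom y = Tisom (affine_mul x y).
Proof. by apply: toeplitz_inj; rewrite toeplitz_opM shiftM. Qed.

Lemma Tisom1 : Tisom (0%N, posn1) = 1.
Proof. by apply: toeplitz_inj; exact: shift1. Qed.

Lemma sX m : s_ ^+ m = Tisom (m, posn1).
Proof.
elim: m => [|m IH]; first by rewrite expr0 Tisom1.
rewrite exprS IH TisomM; congr (Tisom (_, _)); first by rewrite /= mul1n.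
exact: val_inj.
Qed.

Lemma sv m a : s_ ^+ m * v_ a = Tisom (m, a).
Proof.
rewrite sX TisomM; congr (Tisom (_, _)); first by rewrite /= addn0.
by apply: val_inj; rewrite /= mul1n.
Qed.

Lemma monomialE m n a b : s_ ^+ m * v_ a * adj (v_ b) * adj s_ ^+ n = monomial (m, a) (n, b).
Proof. by rewrite sv -mulrA -adjX -adjM sv. Qed.

(** The dynamics is prescribed at primes only; splitting off the least prime divisor extends it to
    all [a], with the logarithm turning products into sums of weights. *)
Lemma weighted_v a : weighted (v_ a) (ln (val a)%:R).
Proof.
case: a => a a0 /=; have [n] := ubnP a; elim: n a a0 => // n IH a a0 an.
have [a1|a1] := leqP a 1.
  have -> : v_ (exist _ a a0) = 1 :> T.
    rewrite -Tisom1; congr (Tisom (_, _)); apply: val_inj => /=; lia.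
  have -> : a = 1%N by lia.
  by rewrite ln1; exact: weighted1.
pose p := pdiv a; have pp : prime p := pdiv_prime a1.
have p0 := prime_gt0 pp; have b0 : (0 < a %/ p)%N by rewrite divn_gt0// dvdn_leq// pdiv_dvd.
have E : v_ (exist _ a a0) = v_ (exist (fun a => (0 < a)%N) p p0)
    * v_ (exist (fun a => (0 < a)%N) (a %/ p)%N b0) :> T.
  rewrite TisomM; congr (Tisom (_, _)); first by rewrite /= muln0.
  by apply: val_inj => /=; rewrite mulnC divnK// pdiv_dvd.
have -> : ln a%:R = ln p%:R + ln (a %/ p)%:R :> R.
  by rewrite -lnM ?posrE ?ltr0n// -natrM mulnC divnK// pdiv_dvd.
rewrite E; apply: weightedM.
  move=> t; have [_ _ _ /(_ t)[_ /(_ (exist _ p p0) pp)]] := dyn.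
  by rewrite /= => ->; rewrite /cexp /= expR0 mul1r.
apply: IH; rewrite (leq_trans (ltn_Pdiv (prime_gt1 pp) a0))//.
Qed.

Lemma weighted_s : weighted s_ 0.
Proof. by move=> t; have [_ _ _ /(_ t)[-> _]] := dyn; rewrite mulr0 cexp0 scale1r. Qed.

Lemma weighted_Tisom x : weighted (Tisom x) (ln (val x.2)%:R).
Proof.
case: x => m a; rewrite -sv -[ln _]add0r; apply: weightedM (weighted_v a).
elim: m => [|m IH]; first by rewrite expr0; exact: weighted1.
by rewrite exprS -[0]addr0; exact: weightedM weighted_s IH.
Qed.

Lemma weighted_monomial x y : weighted (monomial x y) (ln (val x.2)%:R - ln (val y.2)%:R).
Proof. by apply: weightedM (weighted_Tisom x) _; exact/weighted_adj/weighted_Tisom. Qed.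

Lemma weighted_entire c w : weighted c w ->
  entire_extension sigma c (fun z : C^o => cexp ((0 +i* w) * z) *: c).
Proof.
move=> h; split=> [z|t]; last first.
  rewrite h; congr (cexp _ *: _); apply/eqP; rewrite eq_complex /=.
  by rewrite !mul0r mulr0 subr0 add0r mulrC !eqxx.
have hk : holo (fun z : C^o => cexp ((0 +i* w) * z)).
  exact: (holo_comp (@holo_cexp R) (holoM (holo_cst (0 +i* w)) holo_id)).
have [l Hl] := holo_diff z hk.
suff : is_derive z 1 (fun z : C^o => cexp ((0 +i* w) * z) *: c) (l *: c) by case.
apply/is_deriveCP => e e_gt0.
have c1 : 0 < 1 + cnorm c by apply: ltr_pwDl; [exact: ltr01|exact: cnorm_ge0].
have [|d d_gt0 hd] := Hl (e / (1 + cnorm c)); first exact: divr_gt0.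
exists d => // k /hd hk'.
rewrite scalerA -!scalerBl cnormZ.
apply: le_trans (ler_wpM2r (cnorm_ge0 _) hk') _.
rewrite mulrAC; apply: ler_wpM2r; first exact: cnorm_ge0.
by apply: le_div1D => //; [rewrite divr_ge0// ltW|exact: cnorm_ge0].
Qed.

End Dynamics.

(** * KMS states *)

Section KMSStates.
Variable R : realType.
Local Notation C := R[i].
Local Notation T := (toeplitz R).
Local Notation Tisom := (@Tisom R).
Local Notation monomial := (@monomial R).
Local Notation lnn a := (ln (val (a : posn))%:R : R).
Implicit Types (x y : affine) (c d g : T) (a b : posn) (w : R).

Lemma adj_TisomM x y : adj (Tisom (affine_mul x y)) = adj (Tisom y) * adj (Tisom x).
Proof. by rewrite -TisomM adjM. Qed.

Lemma adj_Tisom_cancel x : adj (Tisom x) * Tisom x = 1.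
Proof. by apply: toeplitz_inj; rewrite toeplitz_opM adj_Tisom_op; exact: coshift_shift. Qed.

Lemma adj_Tisom_disjoint x y : (forall z z', affine_mul x z <> affine_mul y z') ->
  adj (Tisom x) * Tisom y = 0.
Proof.
by move=> h; apply: toeplitz_inj; rewrite toeplitz_opM adj_Tisom_op; exact: coshift_shift_disjoint.
Qed.

Lemma adj_Tisom_mulr x y : adj (Tisom x) * Tisom (affine_mul x y) = Tisom y.
Proof. by rewrite -TisomM mulrA adj_Tisom_cancel mul1r. Qed.

Lemma adj_Tisom_mull x y : adj (Tisom (affine_mul x y)) * Tisom x = adj (Tisom y).
Proof. by rewrite adj_TisomM -mulrA adj_Tisom_cancel mulr1. Qed.

Lemma adj_s_s m n : adj (Tisom (n, posn1)) * Tisom (m, posn1) = spow (m%:Z - n%:Z).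
Proof.
have E k l : affine_mul (k, posn1) (l, posn1) = ((k + l)%N, posn1).
  by congr pair; [rewrite /= mul1n|exact: val_inj].
have [nm|mn] := leqP n m.
  by rewrite -{1}(subnKC nm) -E adj_Tisom_mulr subzn//= sX.
(* [Negz k] stands for [- (k + 1)], hence the predecessor. *)
have -> : m%:Z - n%:Z = Negz (n - m).-1 by lia.
rewrite -{1}(subnKC (ltnW mn)) -E adj_Tisom_mull.
by rewrite -[RHS]/(adj s_ ^+ (n - m).-1.+1) prednK ?subn_gt0// -adjX sX.
Qed.

Lemma affine_mul_s n a : affine_mul (1%N, posn1) (n, a) = (n.+1, a).
Proof. by congr pair; [rewrite /= mul1n add1n|apply: val_inj; rewrite /= mul1n]. Qed.

Lemma affine_mul_v a n b : affine_mul (0%N, a) (n, b) = ((val a * n)%N, posn_mul a b).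
Proof. by []. Qed.

Lemma affine_mulr_s n a : affine_mul (n, a) (1%N, posn1) = ((n + val a)%N, a).
Proof. by congr pair; [rewrite /= muln1|apply: val_inj; rewrite /= muln1]. Qed.

(** The relation [v_a^* s = s v_a^* s^{*(a-1)}]: the least common right multiple of [(0, a)] and
    [(1, 1)] is [(a, a)]. It moves [s] to the left when there is no [s^*] to cancel it. *)
Lemma adj_Tisom0_s a :
  adj (Tisom (0%N, a)) * s_ = Tisom (1%N, posn1) * adj (Tisom ((val a).-1, a)).
Proof.
have [j aE] : exists j, val a = j.+1 by exists (val a).-1; rewrite prednK// (valP a).
apply: toeplitz_inj; rewrite !toeplitz_opM !adj_Tisom_op; apply: coshift_shift_lcm.
  by rewrite affine_mulr_s affine_mul_s aE.
move=> [k e] [l f] [h1 h2]; rewrite /= in h1 h2.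
rewrite add0n mul1n add1n in h1; rewrite mul1n in h2.
case: k h1 => [|k] h1; first by rewrite muln0 in h1.
exists (k, e); first by rewrite affine_mul_s.
congr pair; first by rewrite /= aE; move: h1; rewrite aE; lia.
exact: val_inj.
Qed.

Lemma adj_Tisom_indivisible a b n : ~~ (val a %| n)%N ->
  adj (Tisom (n, posn_mul a b)) * Tisom (0%N, a) = 0.
Proof.
move=> an; apply: adj_Tisom_disjoint => -[k e] [l f] [h _]; rewrite /= add0n in h.
by move/negP: an; apply; rewrite -(@dvdn_addl (val a * val b * k)) ?h ?dvdn_mulr// -mulnA dvdn_mulr.
Qed.

(** Right ideals of [(n, a)] and [(m, a)] meet only if [m] and [n] agree modulo [a]. In that case
    [s^k v_a] factors as [s^(k mod a) v_a s^(k div a)], the common isometry cancels, and only powers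
    of [s] remain. *)
Lemma adj_Tisom_same a m n : adj (Tisom (n, a)) * Tisom (m, a) =
  if (m == n %[mod val a])%N then spow ((m%:Z - n%:Z) %/ (val a)%:Z)%Z else 0.
Proof.
have a0 : (0 < val a)%N := valP a.
case: ifPn => [/eqP mn|mn]; last first.
  apply: adj_Tisom_disjoint => -[k e] [l f] [h _]; rewrite /= in h.
  move/negP: mn; apply; apply/eqP.
  by rewrite -(modnMDl l m (val a)) -(modnMDl k n (val a)) ![(_ * val a)%N]mulnC addnC -h addnC.
have E k : (k, a) = affine_mul (k %% val a, a)%N (k %/ val a, posn1)%N.
  congr pair; first by rewrite /= mulnC addnC -divn_eq.
  by apply: val_inj; rewrite /= muln1.
rewrite (E n) (E m) mn adj_TisomM -mulrA -TisomM [adj (Tisom (_ %% _, _)%N) * _]mulrA.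
rewrite adj_Tisom_cancel mul1r adj_s_s; congr spow.
rewrite {2}(divn_eq m (val a)) {2}(divn_eq n (val a)) mn.
rewrite !PoszD !PoszM opprD addrACA subrr addr0 -mulrBl mulzK//.
by rewrite eqz_nat -lt0n.
Qed.

Lemma lnn_inj a b : lnn a = lnn b -> a = b.
Proof.
move=> h; apply/val_inj/eqP; rewrite -(eqr_nat R); apply/eqP.
by apply: ln_inj h; rewrite posrE ltr0n; exact: valP.
Qed.

Lemma lnnM a b : lnn (posn_mul a b) = lnn a + lnn b.
Proof. by rewrite -lnM ?posrE ?ltr0n ?(valP a) ?(valP b)// -natrM. Qed.

Lemma powR_lnn a (beta : R) : (val a)%:R `^ beta = expR (beta * lnn a).
Proof. by rewrite /powR pnatr_eq0 eqn0Ngt (valP a). Qed.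

Lemma cexp_imaginary w (beta : R) :
  cexp ((0 +i* w) * (0 +i* beta : R[i]^o)) = (expR (- (beta * w)))%:C.
Proof.
by rewrite /cexp /= !mul0r mulr0 addr0 sub0r cos0 sin0 mulr1 [w * _]mulrC.
Qed.

(** * The two implications for a fixed state *)

Section Fixed.
Variables (sigma : R -> T -> T) (beta : R) (phi : {linear T -> R[i]^o}).
Hypotheses (dyn : dynamics sigma) (beta1 : 1 <= beta) (phi_state : state phi).

Let beta0 : 0 < beta. Proof. exact: lt_le_trans ltr01 beta1. Qed.
Let bphi : bounded_functional phi. Proof. exact: state_bounded. Qed.

Let analytic_weighted c w : weighted sigma c w -> analytic sigma c.
Proof. by move=> h; eexists; exact: weighted_entire h. Qed.

Lemma KMS_weighted c d w w' : KMS sigma beta phi -> weighted sigma c w' -> weighted sigma d w ->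
  phi (d * c) = (expR (- (beta * w)))%:C * phi (c * d).
Proof.
move=> K hc hd; rewrite (K _ _ _ (analytic_weighted hc) (weighted_entire hd)) cexp_imaginary.
by rewrite toeplitz_scalerAr linearZ.
Qed.

Lemma KMS_monomial a b m n : KMS sigma beta phi ->
  phi (monomial (m, a) (n, b)) =
     if (a == b) && (m == n %[mod val a])%N
     then ((val a)%:R `^ (- beta))%:C
          * phi (spow ((m%:Z - n%:Z) %/ (val a)%:Z)%Z)
     else 0.
Proof.
move=> K; have [<-|ab] := eqVneq a b; last first.
  have := KMS_weighted K (weighted1 dyn) (weighted_monomial dyn (m, a) (n, b)).
  rewrite mulr1 mul1r /= => h; apply/eqP.
  have : (1 - (expR (- (beta * (lnn a - lnn b))))%:C) * phi (monomial (m, a) (n, b)) == 0.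
    by rewrite mulrBl mul1r -h subrr.
  rewrite mulf_eq0 => /orP[|//]; rewrite subr_eq0 => /eqP[].
  rewrite -[X in X = _ -> _]expR0 => /expR_inj/esym/eqP.
  rewrite oppr_eq0 mulf_eq0 gt_eqF//= subr_eq0 => /eqP/lnn_inj abE.
  by rewrite abE eqxx in ab.
have := KMS_weighted K (weighted_adj dyn (weighted_Tisom dyn (n, a))) (weighted_Tisom dyn (m, a)).
rewrite /= -/(monomial (m, a) (n, a)) adj_Tisom_same => ->; rewrite powR_lnn mulNr.
by case: ifP => // _; rewrite linear0 mulr0.
Qed.

Hypothesis formula : forall a b m n, phi (monomial (m, a) (n, b)) =
     if (a == b) && (m == n %[mod val a])%N
     then ((val a)%:R `^ (- beta))%:C
          * phi (spow ((m%:Z - n%:Z) %/ (val a)%:Z)%Z)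
     else 0.

Let phi_diag a m n : phi (monomial (m, a) (n, a)) = if (m == n %[mod val a])%N
     then ((val a)%:R `^ (- beta))%:C * phi (spow ((m%:Z - n%:Z) %/ (val a)%:Z)%Z) else 0.
Proof. by rewrite formula eqxx. Qed.

(** Moving [s] or [s^*] from one side of a monomial to the other changes both exponents by the same
    amount, so this invariance is the KMS relation for [s] and [s^*]. *)
Let phi_translate a m n k :
  phi (monomial ((m + k)%N, a) ((n + k)%N, a)) = phi (monomial (m, a) (n, a)).
Proof.
rewrite !phi_diag eqn_modDr !PoszD; congr (if _ then _ * phi (spow (_ %/ _)%Z) else _).
ring.
Qed.

(** The formula sees [m], [n], [a] only through [a^(- beta)] and the quotient of [m - n] by [a], and
    dilation by [c] leaves the quotient unchanged. This is the KMS relation for [v_c] and [v_c^*]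
    when they can be absorbed. *)
Let phi_dilate (c a : posn) m n :
  phi (monomial ((val c * m)%N, posn_mul c a) ((val c * n)%N, posn_mul c a)) =
  (expR (- (beta * lnn c)))%:C * phi (monomial (m, a) (n, a)).
Proof.
rewrite !phi_diag -[val (posn_mul c a)]/(val c * val a)%N -!muln_modr eqn_pmul2l ?(valP c)//.
case: ifP => _; last by rewrite mulr0.
rewrite -[(val c * val a)%N]/(val (posn_mul c a)) mulrA -RtoCM !powR_lnn lnnM mulrDr expRD !mulNr.
congr (_ * phi (spow _)).
by rewrite -[val (posn_mul c a)]/(val c * val a)%N !PoszM -mulrBr divzMpl// ltz_nat (valP c).
Qed.

(** If [v_c] cannot be absorbed on the right, the product there is 0; this is the matching zero for
    the product with [v_c] on the left. Congruence modulo [c * a] would carry divisibility by [c]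
    over to [n]. *)
Let phi_indivisible_r (c a : posn) m n : ~~ (val c %| n)%N ->
  phi (monomial ((val c * m)%N, posn_mul c a) (n, posn_mul c a)) = 0.
Proof.
move=> cn; rewrite phi_diag -[val (posn_mul c a)]/(val c * val a)%N.
case: ifP => // /eqP h; exfalso; move/negP: cn; apply.
have /dvdnP[q qE] : (val c %| n %% (val c * val a))%N.
  by rewrite -h -muln_modr dvdn_mulr.
by rewrite (divn_eq n (val c * val a)) qE dvdn_addl dvdn_mull// dvdn_mulr.
Qed.

Let phi_indivisible_l (c a : posn) m n : ~~ (val c %| m)%N ->
  phi (monomial (m, posn_mul c a) ((val c * n)%N, posn_mul c a)) = 0.
Proof.
move=> cn; rewrite phi_diag -[val (posn_mul c a)]/(val c * val a)%N.
case: ifP => // /eqP h; exfalso; move/negP: cn; apply.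
have /dvdnP[q qE] : (val c %| m %% (val c * val a))%N.
  by rewrite h -muln_modr dvdn_mulr.
by rewrite (divn_eq m (val c * val a)) qE dvdn_addl dvdn_mull// dvdn_mulr.
Qed.

Let phi_invariant t c : phi (sigma t c) = phi c.
Proof.
have [aut _ _ _] := dyn.
apply: (functional_ext (f := fun c => phi (sigma t c))) => // [|x y].
  apply: (bounded_comp (K := 1) bphi) => [k a b|{}c]; first by have [h _ _ _] := aut t; exact: h.
  by rewrite mul1r; exact: automorphism_contractive.
rewrite (weighted_monomial dyn) linearZ /=; case: x y => [m a] [n b] /=.
rewrite formula; have [->|_] := eqVneq a b; last by rewrite scaler0.
by rewrite subrr mulr0 cexp0 scale1r.
Qed.

Let phi_weighted c w : weighted sigma c w -> w != 0 -> phi c = 0.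
Proof.
(* At time [pi / w] the eigenvalue is [-1], so invariance reads [- phi c = phi c]. *)
move=> h w0; have := phi_invariant (pi / w) c.
rewrite h linearZ /= divfK// /cexp /= expR0 cospi sinpi mul1r.
rewrite -[_ *: phi c]/(_ * phi c); case: (phi c) => u v []; simpc => /= h1 h2.
by apply/eqP; rewrite eq_complex /=; apply/andP; split; apply/eqP; lra.
Qed.

Definition twist g w := forall d, phi (d * g) = (expR (beta * w))%:C * phi (g * d).

Let twistM g g' w w' : twist g w -> twist g' w' -> twist (g * g') (w + w').
Proof.
move=> h h' d; rewrite mulrA h' mulrA h mulrA -RtoCM -expRD -mulrDr addrC.
by rewrite !mulrA.
Qed.

(** Both sides are bounded functionals of [d], so monomials suffice. When the weights of [g] and the
    monomial do not cancel, both sides vanish by invariance; when they do, injectivity of the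
    logarithm ties [x.2] to [y.2]. *)
Let twist_on_monomials g w : weighted sigma g w ->
  (forall x y, w + lnn x.2 = lnn y.2 ->
    phi (monomial x y * g) = (expR (beta * w))%:C * phi (g * monomial x y)) -> twist g w.
Proof.
move=> hg h; apply: functional_ext => [||x y].
- exact: bounded_mulr.
- exact/bounded_scale/bounded_mull.
have [/eqP|w0] := boolP (w + lnn x.2 == lnn y.2); first exact: h.
have hx := weighted_monomial dyn x y.
rewrite (phi_weighted (weightedM dyn hx hg)); last first.
  by apply: contra w0; rewrite addrAC subr_eq0 addrC.
rewrite (phi_weighted (weightedM dyn hg hx)) ?mulr0//.
by apply: contra w0; rewrite addrA subr_eq0.
Qed.

Let twist_s : twist s_ 0.
Proof.
apply: (twist_on_monomials (weighted_s dyn)) => -[m a] [n b] /=.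
rewrite add0r => /lnn_inj <-; rewrite mulr0 expR0 mul1r.
rewrite /monomial mulrA TisomM affine_mul_s -/(monomial _ _).
(* For [n = 0] no [s^*] is left to cancel the incoming [s]; passing it through [v_a^*] leads to
   exponents that are those of the other side translated by [a - 1]. Otherwise the translation is by
   1. *)
case: n => [|n].
  rewrite -mulrA adj_Tisom0_s mulrA TisomM.
  rewrite affine_mulr_s -/(monomial _ _) -(phi_translate a m.+1 0 (val a).-1) add0n.
  by rewrite addSn -addnS prednK// (valP a).
rewrite -mulrA -affine_mul_s adj_Tisom_mull -/(monomial _ _) affine_mul_s.
by rewrite -(phi_translate a m n 1) !addn1.
Qed.

Let twist_adj_s : twist (adj s_) 0.
Proof.
have hs : weighted sigma (adj s_) 0 by rewrite -oppr0; exact: weighted_adj (weighted_s dyn).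
apply: (twist_on_monomials hs) => -[m a] [n b] /=.
rewrite add0r => /lnn_inj <-; rewrite mulr0 expR0 mul1r.
rewrite /monomial -mulrA -adj_TisomM affine_mul_s -/(monomial _ _) mulrA.
case: m => [|m].
  have -> : adj s_ * Tisom (0%N, a) = Tisom ((val a).-1, a) * adj (Tisom (1%N, posn1)).
    by rewrite -[LHS]adjK adjM adjK adj_Tisom0_s adjM adjK.
  rewrite -mulrA -adj_TisomM affine_mulr_s -/(monomial _ _).
  rewrite -(phi_translate a 0 n.+1 (val a).-1) add0n.
  by rewrite addSn -addnS prednK// (valP a).
rewrite -affine_mul_s adj_Tisom_mulr affine_mul_s -/(monomial _ _).
by rewrite -(phi_translate a m n 1) !addn1.
Qed.

Let twist_v (c : posn) : twist (v_ c) (lnn c).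
Proof.
apply: (twist_on_monomials (weighted_v dyn c)) => -[m a] [n b] /=.
rewrite -lnnM => /lnn_inj <-; rewrite /monomial mulrA TisomM affine_mul_v -/(monomial _ _).
have [/dvdnP[q ->]|cn] := boolP (val c %| n)%N; last first.
  by rewrite -mulrA adj_Tisom_indivisible// mulr0 linear0 phi_indivisible_r// mulr0.
rewrite [(q * _)%N]mulnC -affine_mul_v -mulrA adj_Tisom_mull affine_mul_v -/(monomial _ _).
by rewrite (phi_dilate c a m q) mulrA -RtoCM -expRD subrr expR0 mul1r.
Qed.

Let twist_adj_v (c : posn) : twist (adj (v_ c)) (- lnn c).
Proof.
apply: (twist_on_monomials (weighted_adj dyn (weighted_v dyn c))) => -[m a] [n b] /= /eqP.
rewrite addrC subr_eq addrC -lnnM => /eqP/lnn_inj ->.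
rewrite /monomial -mulrA -adj_TisomM affine_mul_v -/(monomial _ _) mulrA mulrN.
have [/dvdnP[q ->]|cn] := boolP (val c %| m)%N; last first.
  have -> : adj (v_ c) * Tisom (m, posn_mul c b) = 0.
    rewrite -[LHS]adjK adjM adjK adj_Tisom_indivisible//.
    by rewrite -[0 in LHS](scale0r (0 : T)) adjZ rmorph0 scale0r.
  by rewrite mul0r linear0 phi_indivisible_l// mulr0.
by rewrite [(q * _)%N]mulnC (phi_dilate c b q n) -affine_mul_v adj_Tisom_mulr.
Qed.

Let twist1 : twist 1 0.
Proof. by move=> d; rewrite mulr1 mul1r mulr0 expR0 mul1r. Qed.

Let twistX g n : twist g 0 -> twist (g ^+ n) 0.
Proof.
move=> h; elim: n => [|n IH]; first by rewrite expr0; exact: twist1.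
by rewrite exprS -[0]addr0; exact: twistM.
Qed.

Let twist_monomial x y : twist (monomial x y) (lnn x.2 - lnn y.2).
Proof.
case: x y => [m a] [n b] /=; rewrite -monomialE -[X in twist _ X]addr0.
apply: twistM (twistX _ twist_adj_s); apply: twistM (twist_adj_v b).
by rewrite -[lnn a]add0r; exact: twistM (twistX _ twist_s) (twist_v a).
Qed.

Let holo_functional (f : T -> C^o) (F : C^o -> T) : bounded_functional f -> entire F ->
  holo (fun z => f (F z)).
Proof.
move=> [lin [M hM]] hF z; have /derivableP/is_deriveCP Hl := hF z.
move: ('D_1 F z) Hl => l Hl.
suff : is_derive z 1 (fun z => f (F z)) (f l) by case.
apply/is_deriveCP => e e_gt0.
have M1 : 0 < 1 + `|M| by apply: ltr_pwDl; [exact: ltr01|exact: normr_ge0].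
have [|d d_gt0 hd] := Hl (e / (1 + `|M|)); first exact: divr_gt0.
exists d => // h /hd hh.
have linB u v : f (u - v) = f u - f v.
  by have := lin (-1) v u; rewrite scaleN1r mulN1r addrC => ->; rewrite addrC.
have linZ k u : f (k *: u) = k * f u.
  have := lin k u 0; have := linB 0 0; rewrite !subrr => ->; by rewrite !addr0.
rewrite -[h *: f l]/(h * f l) -linZ -!linB; apply: le_trans (hM _) _.
apply: (@le_trans _ _ (`|M| * (e / (1 + `|M|) * cnorm h))).
  apply: (@le_trans _ _ (`|M| * cnorm (F (z + h) - F z - h *: l))).
    by apply: ler_wpM2r; [exact: cnorm_ge0|exact: ler_norm].
  by apply: ler_wpM2l; [exact: normr_ge0|exact: hh].
rewrite mulrA; apply: ler_wpM2r; first exact: cnorm_ge0.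
by rewrite mulrC; apply: le_div1D; [rewrite divr_ge0// ltW|exact: normr_ge0|].
Qed.

Lemma KMS_of_formula : KMS sigma beta phi.
Proof.
move=> c d F _ [entF extF]; move: c.
(* With [d] and [F] fixed, both sides are bounded functionals of [c], so [c] may be taken to be a
   monomial. *)
apply: functional_ext => [||x y]; [exact: bounded_mull|exact: bounded_mulr|].
set g := monomial x y; have tg := twist_monomial x y.
have wg := weighted_monomial dyn x y; rewrite -/g in tg wg.
move: (lnn x.2 - lnn y.2) tg wg => w tg wg.
rewrite tg; apply/eqP; rewrite eq_sym -subr_eq0; apply/eqP.
(* On the real line [k] vanishes by invariance; at [i beta] the exponential becomes [e^(beta w)], so
   [k = 0] there is the claim. *)
pose k z : C^o := phi (g * F z) - cexp ((0 +i* - w) * z) * phi (g * d).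
have hk : holo k.
  have h1 := holo_functional (bounded_mull g bphi) entF.
  have h2 := holo_comp (@holo_cexp R) (holoM (holo_cst (0 +i* - w)) holo_id).
  have h3 := holoM (holo_cst (- 1)) (holoM h2 (holo_cst (phi (g * d)))).
  have := holoD h1 h3; congr holo; apply/funext => z.
  by rewrite /k mulN1r.
have k0 t : k t%:C = 0.
  rewrite /k extF; have [aut group _ _] := dyn; have [_ mult _ _] := aut t.
  (* The group law transfers [sigma t] from [d], about which nothing is known, to the eigenvector
     [g], at the time [- t]. *)
  have <- : phi (sigma t (sigma (- t) g * d)) = phi (g * sigma t d).
    by rewrite mult; have [_ <-] := group g; rewrite subrr; have [-> _] := group g.
  rewrite phi_invariant wg toeplitz_scalerAl linearZ /=; apply/eqP; rewrite subr_eq0.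
  apply/eqP; congr (cexp _ * _); apply/eqP; rewrite eq_complex /=.
  by rewrite !mul0r !mulr0 subr0 add0r !mulNr [w * t]mulrC !eqxx.
have := entire_real0 hk k0 (ltW beta0).
by rewrite /k cexp_imaginary mulrN opprK.
Qed.

End Fixed.
End KMSStates.

Theorem lemma8p3 (R : realType) (sigma : R -> toeplitz R -> toeplitz R)
    (beta : R) (phi : {linear toeplitz R -> R[i]^o}) :
  dynamics sigma -> 1 <= beta -> state phi ->
  (KMS sigma beta phi <->
   forall (a b : posn) (m n : nat),
     phi (s_ ^+ m * v_ a * adj (v_ b) * adj s_ ^+ n) =
     if (a == b) && (m == n %[mod val a])%N
     then ((val a)%:R `^ (- beta))%:C
          * phi (spow ((m%:Z - n%:Z) %/ (val a)%:Z)%Z)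
     else 0).
Proof.
move=> dyn beta1 phi_state; split=> [K a b m n|formula].
  rewrite monomialE; exact: (KMS_monomial dyn beta1 a b m n K).
apply: (KMS_of_formula dyn beta1 phi_state) => a b m n.
rewrite -monomialE; exact: formula.
Qed.
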